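(* For every $\lambda>0$ and every $n\ge 2$, the Hilbert modules $\mathbb A^{(\lambda)}_{\rm sym}(\mathbb D^n)$ and $\mathbb A^{(\lambda)}_{\rm anti}(\mathbb D^n)$ over $\mathbb C[\boldsymbol z]^{\mathfrak S_n}$ are not equivalent.
   Context: $\mathbb D^n$ is the open unit polydisc in $\mathbb C^n$. For $\lambda>0$, $\mathbb A^{(\lambda)}(\mathbb D^n)$ is the Hilbert space of holomorphic functions on $\mathbb D^n$ with reproducing kernel $K^{(\lambda)}(\boldsymbol z,\boldsymbol w)=\prod_{j=1}^n(1-z_j\bar w_j)^{-\lambda}$. The symmetric group $\mathfrak S_n$ acts on $\mathbb C^n$ by $\sigma\cdot\boldsymbol z=(z_{\sigma^{-1}(1)},\dots,z_{\sigma^{-1}(n)})$, and $(f\circ\sigma^{-1})(\boldsymbol z)=f(\sigma^{-1}\cdot\boldsymbol z)$. Define the closed subspaces $\mathbb A^{(\lambda)}_{\rm sym}(\mathbb D^n)=\{f\in\mathbb A^{(\lambda)}(\mathbb D^n): f\circ\sigma^{-1}=f\ \text{for all }\sigma\in\mathfrak S_n\}$ (this is $\mathbb P_{(n)}(\mathbb A^{(\lambda)}(\mathbb D^n))$, the isotypic component of the trivial representation) and $\mathbb A^{(\lambda)}_{\rm anti}(\mathbb D^n)=\{f\in\mathbb A^{(\lambda)}(\mathbb D^n): f\circ\sigma^{-1}=\mathrm{sgn}(\sigma)f\ \text{for all }\sigma\in\mathfrak S_n\}$ (this is $\mathbb P_{(1,\dots,1)}(\mathbb A^{(\lambda)}(\mathbb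 D^n))$, the isotypic component of the sign representation). Both are Hilbert modules over the ring $\mathbb C[\boldsymbol z]^{\mathfrak S_n}$ of symmetric polynomials under pointwise multiplication. Two Hilbert modules over $\mathbb C[\boldsymbol z]^{\mathfrak S_n}$ are equivalent if there is a unitary operator between them intertwining multiplication by every symmetric polynomial. *)

(* Defs.v *)
From mathcomp Require Import all_boot all_order all_algebra all_fingroup.
From mathcomp Require Import all_classical all_reals all_analysis.
From mathcomp Require Import complex.
(* Required but not imported: its notations clash with those of analysis. *)
From mathcomp.multinomials Require mpoly.

Set Implicit Arguments.
Unset Strict Implicit.
Unset Printing Implicit Defensive.

Import Order.TTheory GRing.Theory Num.Theory.
Import numFieldNormedType.Exports.

Local Open Scope classical_set_scope.
Local Open Scope ring_scope.

Section HilbertSpacesOfFunctions.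
Variables (R : realType) (X : Type).
Local Notation C := R[i].

(* The algebraic operations are the pointwise ones.  The values of [dotp]
   outside [carrier] are irrelevant; it is linear in its first argument. *)
Record hilbert_space_of_functions := HilbertSpaceOfFunctions {
  carrier : set (X -> C);
  dotp : (X -> C) -> (X -> C) -> C;
  carrier0 : carrier 0;
  carrier_lin : forall (a : C) f g,
    carrier f -> carrier g -> carrier (a *: f + g);
  dotp_lin : forall (a : C) f g h, carrier f -> carrier g -> carrier h ->
    dotp (a *: f + g) h = a * dotp f h + dotp g h;
  dotp_conj : forall f g, carrier f -> carrier g -> dotp g f = (dotp f g)^*;
  dotp_gt0 : forall f, carrier f -> f != 0 -> 0 < dotp f f;
  carrier_complete : forall u : nat -> X -> C,
    (forall k, carrier (u k)) ->
    (forall e : R, 0 < e -> exists N : nat, forall j k : nat,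
       (N <= j)%N -> (N <= k)%N ->
       Num.sqrt (complex.Re (dotp (u j - u k) (u j - u k))) < e) ->
    exists2 f, carrier f &
      forall e : R, 0 < e -> exists N : nat, forall k : nat, (N <= k)%N ->
        Num.sqrt (complex.Re (dotp (u k - f) (u k - f))) < e
}.

Definition reproducing_kernel (H : hilbert_space_of_functions)
    (K : X -> X -> C) : Prop :=
  forall w : X, carrier H (K ^~ w) /\
    forall f, carrier H f -> dotp H f (K ^~ w) = f w.

Definition unitary_between (H : hilbert_space_of_functions)
    (M N : set (X -> C)) (U : (X -> C) -> (X -> C)) : Prop :=
  [/\ forall f, M f -> N (U f),
      forall (a : C) f g, M f -> M g -> U (a *: f + g) = a *: U f + U g,
      forall f g, M f -> M g -> dotp H (U f) (U g) = dotp H f g &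
      forall g, N g -> exists2 f, M f & U f = g].

End HilbertSpacesOfFunctions.

Section Polydisc.
Variables (R : realType) (n : nat).
Local Notation C := R[i].

Definition polydisc : set 'rV[C]_n := [set z | forall j, `|z 0 j| < 1].

(* [f] is defined on the polydisc only; it is extended by 0 in order to apply
   the library's Frechet differentiability over C.  The polydisc being open,
   the extension does not matter.  C^o is C with its normed space structure. *)
Definition holomorphic (f : polydisc -> C) : Prop :=
  forall z : 'rV[C^o]_n, polydisc z ->
    differentiable ('valL_ 0 f : 'rV[C^o]_n -> C^o) z.

(* Principal value of z ^ s on the right half-plane Re z > 0, where the
   principal argument of z is atan (Im z / Re z). *)
Definition half_plane_power (z : C) (s : R) : C :=
  let theta := atan (complex.Im z / complex.Re z) in
  (powR (complex.Re `|z|) s)%:C%C * (cos (s * theta) +i* sin (s * theta))%C.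

(* 1 - zeta lies in the right half-plane whenever |zeta| < 1. *)
Definition bergman_kernel (lambda : R) (z w : polydisc) : C :=
  \prod_(j < n)
    half_plane_power (1 - val z 0 j * (val w 0 j)^*) (- lambda).

Definition weighted_bergman_space (lambda : R)
    (A : hilbert_space_of_functions R polydisc) : Prop :=
  (forall f, carrier A f -> holomorphic f) /\
  reproducing_kernel A (bergman_kernel lambda).

Lemma polydisc_perm (s : 'S_n) (z : polydisc) :
  col_perm (s^-1)%g (val z) \in polydisc.
Proof.
apply/mem_set => j; rewrite mxE; exact: (set_valP z).
Qed.

(* s . z = (z_(s^-1 1), ..., z_(s^-1 n)) *)
Definition perm_act (s : 'S_n) (z : polydisc) : polydisc :=
  SigSub (polydisc_perm s z).

Definition comp_perm_inv (f : polydisc -> C) (s : 'S_n) : polydisc -> C :=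
  fun z => f (perm_act (s^-1)%g z).

Definition sym_part (A : hilbert_space_of_functions R polydisc) :
    set (polydisc -> C) :=
  [set f | carrier A f /\ forall s : 'S_n, comp_perm_inv f s = f].

Definition anti_part (A : hilbert_space_of_functions R polydisc) :
    set (polydisc -> C) :=
  [set f | carrier A f /\
           forall s : 'S_n, comp_perm_inv f s = ((-1) ^+ s : C) *: f].

Definition poly_fun (p : mpoly.mpoly n C) : polydisc -> C :=
  fun z => mpoly.meval (fun j => val z 0 j) p.

(* Equivalence of two Hilbert modules over the symmetric polynomials, both
   carrying the inner product of A and pointwise multiplication. *)
Definition equivalent_sym_modules (A : hilbert_space_of_functions R polydisc)
    (M N : set (polydisc -> C)) : Prop :=
  exists U, unitary_between A M N U /\
    forall p : mpoly.mpoly n C, p \is mpoly.symmetric ->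
      forall f, M f -> U (poly_fun p * f) = poly_fun p * U f.

End Polydisc.

Arguments polydisc R n : clear implicits.

(* Main.v *)
Require Import Defs.
From mathcomp Require Import all_boot all_order all_algebra.
From mathcomp Require Import all_classical all_reals all_analysis.
From mathcomp Require Import complex.
From mathcomp Require Import fingroup perm cyclic separable cyclotomic.
From mathcomp Require Import ring lra zify.
(* Only the structures of mpoly: its notations clash with those of analysis. *)
From mathcomp.multinomials Require Import (canonicals, coercions) mpoly.

(* Put a_i for the coefficients of (1 - x)^(-lambda).  The monomials are
   orthogonal in A, with |z^m|^2 = 1 / prod_j a_(m_j), and total.  To see that
   they belong to A, average the kernels K(., w) over the points w whose
   coordinates are r times N-th roots of unity, against the character
   w |-> w^m / |w^m|: as N grows the averages converge in A to a multiple of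
   z^m, and pairing f with them extracts the m-th Taylor coefficient of f
   without complex integration.

   Let U be an equivalence and g = U 1.  Let alt be the antisymmetrization of
   z^delta, delta = (0, 1, .., n - 1), and h the symmetric function with
   U h = alt.  For m <> 0 let p be the symmetrization of z^m; then
   <p, h> = <p g, alt> is a multiple of the z^delta coefficient of p g, and this
   vanishes: exponents of an antisymmetric function are pairwise distinct, so
   none of them is of the form delta - (nonzero exponent).  Hence h is constant
   and |e_1 alt|^2 / |alt|^2 = |e_1|^2 / |1|^2, where e_1 = z_1 + .. + z_n.  As
   e_1 alt is the antisymmetrization of z^(0, .., n - 2, n), this reads
   a_(n-1) / a_n = n / a_1, that is n / (lambda + n - 1) = n / lambda, which
   forces n = 1. *)

Set Implicit Arguments.
Unset Strict Implicit.
Unset Printing Implicit Defensive.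

Import Order.TTheory GRing.Theory Num.Theory.
Import numFieldNormedType.Exports.

Local Open Scope classical_set_scope.
Local Open Scope ring_scope.

Section NumFieldLimits.
Variable K : numFieldType.
Implicit Types (u v : nat -> K) (l : K).

(* Stated over an abstract field because R[i] has no canonical topology. *)
Definition tends_to u l : Prop := u @ \oo --> l.

Lemma tends_toP u l : tends_to u l <->
  forall e : K, 0 < e -> exists N, forall k, (N <= k)%N -> `|u k - l| < e.
Proof.
split.
  move=> /cvgrPdist_lt ul e e0; have [N _ HN] := ul e e0.
  by exists N => k Nk; rewrite distrC; exact: HN.
move=> ul; apply/cvgrPdist_lt => e e0; have [N HN] := ul e e0.
by exists N => // k Nk /=; rewrite distrC; exact: HN.
Qed.

Lemma tends_to_unique u l l' : tends_to u l -> tends_to u l' -> l = l'.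
Proof. by move=> ul ul'; exact: (cvg_unique (@norm_hausdorff _ _) ul ul'). Qed.

Lemma tends_to_cst l : tends_to (fun=> l) l.
Proof. exact: cvg_cst. Qed.

Lemma tends_toD u v l m :
  tends_to u l -> tends_to v m -> tends_to (fun k => u k + v k) (l + m).
Proof. exact: cvgD. Qed.

Lemma tends_toB u v l m :
  tends_to u l -> tends_to v m -> tends_to (fun k => u k - v k) (l - m).
Proof. exact: cvgB. Qed.

Lemma tends_toM u v l m :
  tends_to u l -> tends_to v m -> tends_to (fun k => u k * v k) (l * m).
Proof. exact: cvgM. Qed.

Lemma tends_to_sum (I : Type) (r : seq I) (P : pred I) (u : I -> nat -> K) (l : I -> K) :
  (forall i, P i -> tends_to (u i) (l i)) ->
  tends_to (fun k => \sum_(i <- r | P i) u i k) (\sum_(i <- r | P i) l i).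
Proof. by move=> H; apply: cvg_big => //; exact: add_continuous. Qed.

Lemma tends_to_prod (I : Type) (r : seq I) (P : pred I) (u : I -> nat -> K) (l : I -> K) :
  (forall i, P i -> tends_to (u i) (l i)) ->
  tends_to (fun k => \prod_(i <- r | P i) u i k) (\prod_(i <- r | P i) l i).
Proof. by move=> H; apply: cvg_big => //; exact: mul_continuous. Qed.

Lemma tends_to_norm u l : tends_to u l -> tends_to (fun k => `|u k|) `|l|.
Proof. exact: cvg_norm. Qed.

Lemma tends_to_eq_near u v l :
  (exists N, forall k, (N <= k)%N -> u k = v k) -> tends_to u l -> tends_to v l.
Proof.
move=> [N HN] /tends_toP ul; apply/tends_toP => e e0.
have [M HM] := ul e e0; exists (maxn N M) => k.
by rewrite geq_max => /andP[Nk Mk]; rewrite -HN//; exact: HM.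
Qed.

Lemma tends_to_squeeze u v l :
  (exists N, forall k, (N <= k)%N -> `|u k - l| <= v k) ->
  tends_to v 0 -> tends_to u l.
Proof.
move=> [N HN] /tends_toP v0; apply/tends_toP => e e0.
have [M HM] := v0 e e0; exists (maxn N M) => k.
rewrite geq_max => /andP[Nk Mk]; apply: le_lt_trans (HN k Nk) _.
apply: le_lt_trans (HM k Mk); rewrite subr0 ger0_norm//.
exact: le_trans (HN k Nk).
Qed.

Lemma tends_to_comp_shift u l : tends_to u l -> tends_to (fun k => u k.+1) l.
Proof.
move=> /tends_toP ul; apply/tends_toP => e /ul[N HN].
by exists N => k Nk; apply: HN; exact: leqW.
Qed.

Lemma tends_to_le_norm u v l m :
  tends_to u l -> tends_to v m -> (forall k, `|u k| <= `|v k|) -> `|l| <= `|m|.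
Proof.
move=> /tends_to_norm ul /tends_to_norm vm uv.
rewrite real_leNgt ?normr_real//; apply/negP => ml.
have lm : tends_to (fun k => `|u k| - `|v k|) (`|l| - `|m|) by exact: tends_toB.
have lm0 : 0 < `|l| - `|m| by rewrite subr_gt0.
have /tends_toP/(_ _ lm0)[N /(_ N (leqnn N))] := lm.
rewrite distrC; set d := `|l| - `|m| in lm0 *; set e := `|u N| - `|v N|.
have e0 : e <= 0 by rewrite subr_le0.
rewrite ger0_norm; last by rewrite subr_ge0 (le_trans e0 (ltW lm0)).
by rewrite gtrBl => /lt_le_trans/(_ e0); rewrite ltxx.
Qed.

End NumFieldLimits.

Section ComplexLimits.
Variable R : realType.
Local Notation C := R[i].

Lemma gt0_complex (e : C) : 0 < e -> exists2 d : R, 0 < d & e = d%:C%C.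
Proof.
move=> e0; have /complex_realP[d ed] := gtr0_real e0.
by exists d => //; rewrite -ltcR -ed.
Qed.

Lemma tends_to_complex (u : nat -> R) (l : R) :
  u @ \oo --> l -> tends_to (fun k => (u k)%:C%C) (l%:C%C : C).
Proof.
move=> ul; apply/tends_toP => _ /gt0_complex[d d0 ->].
have /tends_toP/(_ d d0)[N HN] : tends_to u l by [].
exists N => k /HN; rewrite -rmorphB normc_def /= expr0n addr0 sqrtr_sqr.
by rewrite ltcR.
Qed.

End ComplexLimits.

Section BinomialSeries.
Variable R : realType.
Local Notation C := R[i].
Implicit Types (l t : R) (m N : nat).

Definition binomial_coef l m : R := \prod_(j < m) ((l + j%:R) / j.+1%:R).

Lemma binomial_coef0 l : binomial_coef l 0 = 1.
Proof. by rewrite /binomial_coef big_ord0. Qed.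

Lemma binomial_coefS l m :
  m.+1%:R * binomial_coef l m.+1 = (l + m%:R) * binomial_coef l m.
Proof.
rewrite /binomial_coef big_ord_recr /= mulrCA mulrC; congr (_ * _).
by rewrite mulrC divfK// pnatr_eq0.
Qed.

Lemma binomial_coef_gt0 l m : 0 < l -> 0 < binomial_coef l m.
Proof.
move=> l0; apply: prodr_gt0 => j _.
by rewrite divr_gt0 ?ltr0n// ltr_wpDr ?ler0n.
Qed.

Lemma binomial_coef_shift l m :
  m.+1%:R * binomial_coef l m.+1 = l * binomial_coef (l + 1) m.
Proof.
elim: m => [|m IH].
  by rewrite binomial_coefS !binomial_coef0 addr0.
have m0 : m.+1%:R != 0 :> R by rewrite pnatr_eq0.
apply: (mulfI m0); rewrite binomial_coefS mulrCA IH mulrCA [RHS]mulrCA.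
rewrite binomial_coefS; congr (_ * (_ * _)).
by rewrite -addrA -natr1 [1 + _]addrC.
Qed.

Lemma bounded_of_eventually_nonincreasing (u : nat -> R) :
  (forall m, 0 <= u m) ->
  (exists M, forall m, (M <= m)%N -> u m.+1 <= u m) ->
  exists B, forall m, u m <= B.
Proof.
move=> u0 [M HM]; exists (\sum_(k < M.+1) u k) => m.
have small k : (k <= M)%N -> u k <= \sum_(k < M.+1) u k.
  move=> kM; rewrite (bigD1 (inord k)) //= inordK ?ltnS// lerDl.
  by rewrite sumr_ge0.
have [/small//|/ltnW Mm] := leqP m M.
apply: le_trans (small M (leqnn _)).
rewrite -(subnKC Mm); elim: (m - M)%N => [|d IH]; first by rewrite addn0.
by rewrite addnS; apply: le_trans (HM _ _) IH; rewrite leq_addr.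
Qed.

Lemma binomial_coef_bounded l (r : R) : 0 < l -> 0 <= r < 1 ->
  exists B, forall m, binomial_coef l m * r ^+ m <= B.
Proof.
move=> l0 /andP[r0 r1]; apply: bounded_of_eventually_nonincreasing.
  by move=> m; rewrite mulr_ge0 ?exprn_ge0// ltW ?binomial_coef_gt0.
have r1' : 0 < 1 - r by rewrite subr_gt0.
pose M := Num.truncn (l / (1 - r)); exists M.+1 => m Mm.
have lm : l <= (1 - r) * m.+1%:R.
  rewrite mulrC -ler_pdivrMr//; apply: ltW; apply: lt_le_trans (truncnS_gt _) _.
  by rewrite ler_nat leqW.
have m0 : 0 < m.+1%:R :> R by rewrite ltr0n.
rewrite exprS mulrA ler_wpM2r ?exprn_ge0//.
rewrite -(ler_pM2l m0) mulrA binomial_coefS mulrAC.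
apply: ler_wpM2r; first by rewrite ltW// binomial_coef_gt0.
have : l * r <= l by rewrite ler_piMr// ltW.
rewrite mulrDl -natr1 in lm *; nra.
Qed.

Lemma cvg_pseries_dominated l (B r K : R) (d : nat -> R) :
  0 < l -> 0 <= r -> 0 <= K -> K * r < 1 ->
  (forall m, `|d m| <= B * (binomial_coef l m * r ^+ m)) ->
  cvgn (pseries d K).
Proof.
move=> l0 r0 K0 Kr dB.
pose q := (1 + K * r) / 2.
have Kr0 : 0 <= K * r by rewrite mulr_ge0.
have q0 : 0 < q by rewrite /q; lra.
have q1 : q < 1 by rewrite /q; lra.
have Krq : K * r / q < 1 by rewrite ltr_pdivrMr// /q; lra.
have [|D HD] := @binomial_coef_bounded l (K * r / q) l0.
  by rewrite Krq andbT divr_ge0// ltW.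
have D0 : 0 <= D.
  apply: le_trans (HD 0%N); rewrite expr0 mulr1 ltW//.
  exact: binomial_coef_gt0.
apply: normed_cvg.
apply: (@series_le_cvg R _ (geometric (`|B| * D) q)).
- by move=> m; exact: normr_ge0.
- by move=> m; exact: mulr_ge0 (mulr_ge0 _ D0) (exprn_ge0 _ (ltW q0)).
- move=> m; rewrite /= normrM normrX (ger0_norm K0).
  apply: (@le_trans _ _ (B * (binomial_coef l m * r ^+ m) * K ^+ m)).
    by rewrite ler_wpM2r ?exprn_ge0.
  rewrite -!mulrA -exprMn [r * K]mulrC.
  have -> : K * r = (K * r / q) * q by rewrite divfK// gt_eqF.
  rewrite exprMn; rewrite 2![leLHS]mulrA [leRHS]mulrA.
  apply: ler_wpM2r; first by rewrite exprn_ge0// ltW.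
  rewrite -mulrA.
  apply: (@le_trans _ _ (`|B| * (binomial_coef l m * (K * r / q) ^+ m))).
    apply: ler_wpM2r (ler_norm B); apply: mulr_ge0.
      by rewrite ltW// binomial_coef_gt0.
    by rewrite exprn_ge0// divr_ge0// ltW.
  exact: ler_wpM2l.
by apply: is_cvg_geometric_series; rewrite ger0_norm// ltW.
Qed.

End BinomialSeries.

Section PowerAlongRay.
Variables (R : realType) (l a b : R).
Local Notation C := R[i].
Implicit Types t : R.

Let X t : R := 1 - t * a.
Let Y t : R := - (t * b).
Let rho t : R := X t * X t + Y t * Y t.
Let modulus t : R := expR (l / 2 * ln (rho t)).
Let argument t : R := l * atan (Y t / X t).

Definition ray_power_re t := modulus t * cos (argument t).
Definition ray_power_im t := modulus t * sin (argument t).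

Let dX t : is_derive t 1 X (- a).
Proof.
apply: is_derive_eq; rewrite scaler0 add0r.
by rewrite /GRing.scale /=; ring.
Qed.

Let dY t : is_derive t 1 Y (- b).
Proof.
apply: is_derive_eq; rewrite scaler0 add0r.
by rewrite /GRing.scale /=; ring.
Qed.
Let rho_gt0 t : 0 < X t -> 0 < rho t.
Proof. by move=> X0; rewrite /rho; nra. Qed.

Let dmodulus t : 0 < X t ->
  is_derive t 1 modulus (modulus t * (l * (- a * X t - b * Y t) / rho t)).
Proof.
move=> X0; have r0 := rho_gt0 X0.
have drho : is_derive t 1 rho (2 * (- a * X t - b * Y t)).
  have dr := is_deriveD (is_deriveM (dX t) (dX t)) (is_deriveM (dY t) (dY t)).
  apply: (is_derive_eq (dr : is_derive t 1 rho _)); rewrite /GRing.scale /=; ring.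
have dl := is_derive1_comp (is_derive1_ln r0) drho.
have de := is_derive1_comp (is_derive_expR _) (is_deriveZ (l / 2) dl).
apply: (is_derive_eq (de : is_derive t 1 modulus _)); rewrite /GRing.scale /=.
by rewrite -/(modulus t); field; rewrite gt_eqF.
Qed.

Let dargument t : 0 < X t -> is_derive t 1 argument (l * (- b / rho t)).
Proof.
move=> X0; have r0 := rho_gt0 X0; have Xn : X t != 0 by rewrite gt_eqF.
have dq := is_deriveM (dY t) (is_deriveV Xn (dX t)).
have da := is_deriveZ l (is_derive1_comp (is_derive1_atan _) dq).
apply: (is_derive_eq (da : is_derive t 1 argument _)); rewrite /GRing.scale /=.
have rn : rho t != 0 by rewrite gt_eqF.
have key : a * Y t - b * X t = - b by rewrite /X /Y; ring.
rewrite -[in RHS]key !fctE; move: rn; rewrite /rho.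
move: (X t) (Y t) Xn => x y Xn rn; field.
by rewrite Xn rn.
Qed.

(* The power p (t) = (1 - t x)^l, x = a + i b, solves (1 - t x) p' = - l x p. *)
Lemma ray_power_ode t : 0 < 1 - t * a ->
  exists dre dim : R, [/\ is_derive t 1 ray_power_re dre,
    is_derive t 1 ray_power_im dim &
    (1 - t%:C * (a +i* b)) * (dre +i* dim) =
    - l%:C * (a +i* b) * (ray_power_re t +i* ray_power_im t) :> C]%C.
Proof.
move=> X0; have Xn : X t != 0 by rewrite gt_eqF.
have rn : rho t != 0 by rewrite gt_eqF ?rho_gt0.
pose q1 := l * (- a * X t - b * Y t) / rho t; pose q2 := l * (- b / rho t).
have h1 : X t * q1 - Y t * q2 = - l * a.
  suff : (X t * X t + Y t * Y t) * a = X t * (a * X t + b * Y t) - b * Y t.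
    move: rn; rewrite /q1 /q2 /rho.
    move: (X t) (Y t) => x y rn e; apply: (mulIf rn).
    transitivity (- l * ((x * x + y * y) * a)); last by ring.
    by rewrite e; field.
  by rewrite /X /Y; ring.
have h2 : X t * q2 + Y t * q1 = - l * b.
  suff : (X t * X t + Y t * Y t) * b = X t * b + Y t * (a * X t + b * Y t).
    move: rn; rewrite /q1 /q2 /rho.
    move: (X t) (Y t) => x y rn e; apply: (mulIf rn).
    transitivity (- l * ((x * x + y * y) * b)); last by ring.
    by rewrite e; field.
  by rewrite /X /Y; ring.
have dm := dmodulus X0; have da := dargument X0.
have dc := is_derive1_comp (is_derive_cos _) da.
have ds := is_derive1_comp (is_derive_sin _) da.
have dre := is_deriveM dm dc; have dim := is_deriveM dm ds.
exists (q1 * ray_power_re t - q2 * ray_power_im t).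
exists (q1 * ray_power_im t + q2 * ray_power_re t); split.
- apply: is_derive_eq dre _.
  by rewrite /GRing.scale /= /ray_power_re /ray_power_im -/q1 -/q2; ring.
- apply: is_derive_eq dim _.
  by rewrite /GRing.scale /= /ray_power_re /ray_power_im -/q1 -/q2; ring.
move: (ray_power_re t) (ray_power_im t) => u w.
apply/eqP; rewrite eq_complex /= !(mul0r, mulr0, addr0, subr0, sub0r, oppr0).
rewrite -/(X t) -/(Y t); apply/andP; split; apply/eqP.
  transitivity ((X t * q1 - Y t * q2) * u - (X t * q2 + Y t * q1) * w); first by ring.
  by rewrite h1 h2.
transitivity ((X t * q1 - Y t * q2) * w + (X t * q2 + Y t * q1) * u); first by ring.
by rewrite h1 h2.
Qed.

End PowerAlongRay.

Lemma half_plane_power_ray (R : realType) (l a b t : R) : 0 < 1 - t * a ->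
  half_plane_power (1 - t%:C * (a +i* b))%C l =
  (ray_power_re l a b t +i* ray_power_im l a b t)%C.
Proof.
move=> X0; rewrite /half_plane_power normc_def /=.
rewrite !(mul0r, mulr0, addr0, subr0, sub0r, oppr0).
set X := 1 - t * a in X0 *; set Y := - (t * b).
have r0 : 0 < X * X + Y * Y by nra.
apply/eqP; rewrite eq_complex /= !mul0r subr0 addr0.
suff -> : powR (Num.sqrt (X ^+ 2 + Y ^+ 2)) l = expR (l / 2 * ln (X * X + Y * Y)).
  by rewrite !eqxx.
rewrite !expr2 /powR gt_eqF ?sqrtr_gt0//; congr expR.
by rewrite -powR12_sqrt ?ltW// ln_powR; field.
Qed.

Lemma half_plane_power_mulN (R : realType) (l : R) (z : R[i]) :
  0 < complex.Re z -> half_plane_power z l * half_plane_power z (- l) = 1.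
Proof.
move=> z0; rewrite /half_plane_power normc_def /=.
set th := atan _; set m := Num.sqrt _.
have m0 : 0 < m by rewrite sqrtr_gt0 ltr_wpDr ?sqr_ge0 ?exprn_gt0.
rewrite mulNr cosN sinN.
have e := cos2Dsin2 (l * th).
have p : powR m l * powR m (- l) = 1.
  by rewrite -powRD subrr ?powRr0 ?eqxx ?gt_eqF.
rewrite mulrACA -rmorphM p mul1r.
apply/eqP; rewrite eq_complex /=; apply/andP; split; apply/eqP; last by ring.
by rewrite -e; ring.
Qed.

Section BinomialTheorem.
Variable R : realType.
Local Notation C := R[i].

Lemma tends_to_pair (u v : nat -> R) (c d : R) :
  u @ \oo --> c -> v @ \oo --> d ->
  tends_to (fun k => (u k +i* v k)%C : C) (c +i* d)%C.
Proof.
move=> uc vd.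
have E (p q : R) : (p +i* q)%C = p%:C%C + 'i%C * q%:C%C :> C by exact: complexE.
rewrite E; under eq_fun do rewrite E.
apply: tends_toD; first exact: tends_to_complex.
by apply: tends_toM; [exact: tends_to_cst | exact: tends_to_complex].
Qed.

Lemma complex_sum (I : Type) (r : seq I) (u v : I -> R) :
  \sum_(i <- r) (u i +i* v i)%C = ((\sum_(i <- r) u i) +i* (\sum_(i <- r) v i))%C :> C.
Proof.
elim: r => [|i r IH]; first by rewrite !big_nil.
by rewrite !big_cons IH; apply/eqP; rewrite eq_complex /= !eqxx.
Qed.

Lemma norm_Re_Im (z : C) :
  `|complex.Re z| <= complex.Re `|z| /\ `|complex.Im z| <= complex.Re `|z|.
Proof.
rewrite normc_def /=.
split; rewrite -sqrtr_sqr; apply: ler_wsqrtr; first by rewrite lerDl sqr_ge0.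
by rewrite lerDr sqr_ge0.
Qed.

Variables (l : R) (x : C).
Hypotheses (l0 : 0 < l) (x1 : `|x| < 1).

Let r : R := complex.Re `|x|.
Let normx : `|x| = r%:C%C. Proof. by rewrite RRe_real ?normr_real. Qed.
Let r0 : 0 <= r. Proof. by rewrite -ler0c -normx. Qed.
Let r1 : r < 1. Proof. by rewrite -ltcR -normx; exact: x1. Qed.

Let cre m : R := binomial_coef l m * complex.Re (x ^+ m).
Let cim m : R := binomial_coef l m * complex.Im (x ^+ m).
Let K : R := 2 / (1 + r).
Let K1 : 1 < K.
Proof. by rewrite /K; have := r0; have := r1; move: r => q *; rewrite ltr_pdivlMr; lra. Qed.
Let K0 : 0 <= K. Proof. exact: ltW (lt_trans ltr01 K1). Qed.
Let Kr : K * r < 1.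
Proof. by rewrite /K; have := r0; have := r1; move: r => q *; rewrite mulrAC ltr_pdivrMr; lra. Qed.

Let re_pow m : `|complex.Re (x ^+ m)| <= r ^+ m.
Proof.
have [+ _] := norm_Re_Im (x ^+ m).
by rewrite normrX normx -rmorphXn.
Qed.

Let im_pow m : `|complex.Im (x ^+ m)| <= r ^+ m.
Proof.
have [_ +] := norm_Re_Im (x ^+ m).
by rewrite normrX normx -rmorphXn.
Qed.

Let r_le1 m : r ^+ m.+1 <= r ^+ m.
Proof. by rewrite exprS ler_piMl ?exprn_ge0// ltW. Qed.

Let dominated0 (w : nat -> R) :
  (forall m, `|w m| <= r ^+ m) ->
  cvgn (pseries (fun m => binomial_coef l m * w m) K).
Proof.
move=> wr; apply: (@cvg_pseries_dominated R l 1 r) => //.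
move=> m; rewrite mul1r normrM (gtr0_norm (binomial_coef_gt0 _ l0)).
by apply: ler_wpM2l; [rewrite ltW// binomial_coef_gt0 | exact: wr].
Qed.

Let dominated1 (w : nat -> R) :
  (forall m, `|w m| <= r ^+ m) ->
  cvgn (pseries (pseries_diffs (fun m => binomial_coef l m * w m)) K).
Proof.
move=> wr; have l1 : 0 < l + 1 := addr_gt0 l0 ltr01.
apply: (@cvg_pseries_dominated R (l + 1) l r) => //.
move=> m; rewrite /pseries_diffs mulrA binomial_coef_shift -mulrA.
rewrite normrM normrM (gtr0_norm l0) (gtr0_norm (binomial_coef_gt0 _ l1)).
apply: ler_wpM2l; first exact: ltW.
apply: ler_wpM2l; first by rewrite ltW// binomial_coef_gt0.
exact: le_trans (wr _) (r_le1 m).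
Qed.

Let dominated2 (w : nat -> R) :
  (forall m, `|w m| <= r ^+ m) ->
  cvgn (pseries (pseries_diffs (pseries_diffs
    (fun m => binomial_coef l m * w m))) K).
Proof.
move=> wr; have l1 : 0 < l + 1 := addr_gt0 l0 ltr01.
have l2 : 0 < l + 1 + 1 := addr_gt0 l1 ltr01.
apply: (@cvg_pseries_dominated R (l + 1 + 1) (l * (l + 1)) r) => //.
move=> m; rewrite /pseries_diffs [m.+2%:R * _]mulrA binomial_coef_shift.
have -> : m.+1%:R * (l * binomial_coef (l + 1) m.+1 * w m.+2) =
    l * (m.+1%:R * binomial_coef (l + 1) m.+1) * w m.+2 by ring.
rewrite binomial_coef_shift [l * (_ * _)]mulrA -[_ * w _]mulrA.
rewrite normrM (gtr0_norm (mulr_gt0 l0 l1)) normrM.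
rewrite (gtr0_norm (binomial_coef_gt0 _ l2)).
apply: ler_wpM2l; first by rewrite mulr_ge0// ltW.
apply: ler_wpM2l; first by rewrite ltW// binomial_coef_gt0.
exact: le_trans (wr _) (le_trans (r_le1 _) (r_le1 m)).
Qed.

Let vre t := limn (pseries cre t).
Let vim t := limn (pseries cim t).
Let dre t := limn (pseries (pseries_diffs cre) t).
Let dim t := limn (pseries (pseries_diffs cim) t).

Let dvre t : `|t| < K -> is_derive t (1 : R) vre (dre t).
Proof.
move=> tK; apply: (@pseries_snd_diffs _ _ K).
- exact: dominated0.
- exact: dominated1.
- exact: dominated2.
- by rewrite (ger0_norm K0).
Qed.

Let dvim t : `|t| < K -> is_derive t (1 : R) vim (dim t).
Proof.
move=> tK; apply: (@pseries_snd_diffs _ _ K).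
- exact: dominated0.
- exact: dominated1.
- exact: dominated2.
- by rewrite (ger0_norm K0).
Qed.

Let V t N : C := \sum_(m < N) (binomial_coef l m * t ^+ m)%:C%C * x ^+ m.
Let D t N : C :=
  \sum_(m < N) (m.+1%:R * binomial_coef l m.+1 * t ^+ m)%:C%C * x ^+ m.+1.

Let complex_scaleE (p : R) (z : C) :
  p%:C%C * z = (p * complex.Re z +i* (p * complex.Im z))%C.
Proof. by case: z => u w; apply/eqP; rewrite eq_complex /= !mul0r subr0 addr0 !eqxx. Qed.

Let cvgV t : `|t| < K -> tends_to (V t) (vre t +i* vim t)%C.
Proof.
move=> tK; have tK' : `|t| < `|K| by rewrite (ger0_norm K0).
have c0 : cvgn (pseries cre t) by apply: is_cvg_pseries_inside tK'; exact: dominated0.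
have c1 : cvgn (pseries cim t) by apply: is_cvg_pseries_inside tK'; exact: dominated0.
have -> : V t = fun N => ((pseries cre t N) +i* (pseries cim t N))%C.
  apply/funext => N; rewrite /V /pseries /series /= !big_mkord -complex_sum.
  apply: eq_bigr => m _; rewrite complex_scaleE /cre /cim.
  by congr (_ +i* _)%C; ring.
exact: tends_to_pair.
Qed.

Let cvgD t : `|t| < K -> tends_to (D t) (dre t +i* dim t)%C.
Proof.
move=> tK; have tK' : `|t| < `|K| by rewrite (ger0_norm K0).
have c0 : cvgn (pseries (pseries_diffs cre) t).
  by apply: is_cvg_pseries_inside tK'; exact: dominated1.
have c1 : cvgn (pseries (pseries_diffs cim) t).
  by apply: is_cvg_pseries_inside tK'; exact: dominated1.
have -> : D t = fun N => ((pseries (pseries_diffs cre) t N) +i*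
                         (pseries (pseries_diffs cim) t N))%C.
  apply/funext => N; rewrite /D /pseries /series /= !big_mkord -complex_sum.
  apply: eq_bigr => m _; rewrite complex_scaleE /pseries_diffs /cre /cim.
  by congr (_ +i* _)%C; ring.
exact: tends_to_pair.
Qed.

Let D_rec t N : D t N.+1 - t%:C%C * x * D t N = l%:C%C * x * V t N.+1.
Proof.
have -> : t%:C%C * x * D t N =
    \sum_(m < N.+1) (m%:R * binomial_coef l m * t ^+ m)%:C%C * x ^+ m.+1.
  rewrite big_ord_recl !mul0r add0r mulr_sumr; apply: eq_bigr => m _.
  by rewrite lift0 [in RHS]exprS [x ^+ m.+2]exprS !rmorphM; ring.
rewrite -sumrB mulr_sumr; apply: eq_bigr => m _.
rewrite binomial_coefS -mulrBl -rmorphB -[in RHS]mulrA [x * _]mulrCA -exprS mulrA.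
by rewrite -rmorphM; congr (_%:C%C * _); ring.
Qed.

Let v_ode t : `|t| < K ->
  (1 - t%:C * x)%C * (dre t +i* dim t)%C = l%:C%C * x * (vre t +i* vim t)%C.
Proof.
move=> tK; have cD := cvgD tK; have cV := cvgV tK.
apply: (@tends_to_unique _ (fun N => D t N.+1 - t%:C%C * x * D t N)).
  rewrite mulrBl mul1r.
  exact: tends_toB (tends_to_comp_shift cD) (tends_toM (@tends_to_cst _ _) cD).
under eq_fun do rewrite D_rec.
exact: tends_toM (@tends_to_cst _ _) (tends_to_comp_shift cV).
Qed.

Let a := complex.Re x.
Let b := complex.Im x.
Let xE : x = (a +i* b)%C. Proof. by rewrite /a /b; case: x. Qed.
Let pre := ray_power_re l a b.
Let pim := ray_power_im l a b.

Let X_gt0 t : `|t| < K -> 0 < 1 - t * a.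
Proof.
move=> tK; rewrite subr_gt0; apply: le_lt_trans (ler_norm _) _.
rewrite normrM; apply: le_lt_trans Kr.
by apply: ler_pM => //; [exact: ltW | exact: (norm_Re_Im x).1].
Qed.

Let product_deriv0 t : `|t| < K ->
  is_derive t (1 : R) (pre * vre - pim * vim) 0 /\
  is_derive t (1 : R) (pre * vim + pim * vre) 0.
Proof.
move=> tK; have [dpre [dpim [d1 d2 ode]]] := @ray_power_ode R l a b t (X_gt0 tK).
have z0 : (1 - t%:C%C * x) != 0.
  apply/eqP => /(congr1 (@complex.Re R)); rewrite xE /= mul0r subr0 => e.
  by have := X_gt0 tK; rewrite e ltxx.
have e : (dpre +i* dpim)%C * (vre t +i* vim t)%C +
         (pre t +i* pim t)%C * (dre t +i* dim t)%C = 0.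
  apply: (mulfI z0); rewrite mulr0 mulrDr mulrA {1}xE ode -xE.
  rewrite [(pre t +i* _)%C * _]mulrC mulrA v_ode// !mulNr.
  by rewrite -/(pre t) -/(pim t); ring.
move/eqP: e; rewrite eq_complex /= => /andP[/eqP e1 /eqP e2].
split.
- apply: is_derive_eq (is_deriveB (is_deriveM d1 (dvre tK)) (is_deriveM d2 (dvim tK))) _.
  by rewrite /GRing.scale /= -[RHS]e1 /pre /pim; ring.
- apply: is_derive_eq (is_deriveD (is_deriveM d1 (dvim tK)) (is_deriveM d2 (dvre tK))) _.
  by rewrite /GRing.scale /= -[RHS]e2 /pre /pim; ring.
Qed.

Let constant (f : R -> R) :
  (forall t, `|t| < K -> is_derive t (1 : R) f 0) -> f 1 = f 0.
Proof.
move=> df; have norm_lt t : t \in `[0, 1] -> `|t| < K.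
  by rewrite in_itv /= => /andP[t0 t1]; rewrite ger0_norm//; exact: le_lt_trans K1.
have [t||c _] := @MVT_segment R f (fun=> 0) 0 1 ler01.
- by move=> /subset_itv_oo_cc/norm_lt; exact: df.
- apply: derivable_within_continuous => t /norm_lt tK.
  by have [] := df t tK.
- by rewrite mul0r => /eqP; rewrite subr_eq0 => /eqP.
Qed.

Lemma binomial_series :
  tends_to (fun N => \sum_(m < N) (binomial_coef l m)%:C%C * x ^+ m)
           (half_plane_power (1 - x) (- l)).
Proof.
have n1 : `|1 : R| < K by rewrite normr1.
have n0 : `|0 : R| < K by rewrite normr0 (lt_trans ltr01 K1).
have V0 : (vre 0 +i* vim 0)%C = 1 :> C.
  apply: (tends_to_unique (cvgV n0)).
  apply: (@tends_to_eq_near _ (fun=> 1)); last exact: tends_to_cst.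
  exists 1%N => -[//|N] _.
  rewrite /V big_ord_recl binomial_coef0 !expr0 !mul1r big1 ?addr0// => m _.
  by rewrite /bump /= expr0n /= mulr0 mul0r.
have p0 : (pre 0 +i* pim 0)%C = 1 :> C.
  rewrite -half_plane_power_ray; last by rewrite mul0r subr0.
  rewrite mul0r subr0 /half_plane_power normr1 /= mul0r atan0 mulr0 cos0 sin0.
  by rewrite powR1 mul1r.
have key : (pre 1 +i* pim 1)%C * (vre 1 +i* vim 1)%C = 1 :> C.
  have h1 := constant (fun t tK => (product_deriv0 tK).1).
  have h2 := constant (fun t tK => (product_deriv0 tK).2).
  transitivity ((pre 0 +i* pim 0)%C * (vre 0 +i* vim 0)%C); last by rewrite p0 V0 mul1r.
  by apply/eqP; rewrite eq_complex; apply/andP; split; apply/eqP; [exact: h1 | exact: h2].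
have := cvgV n1; rewrite /V.
under eq_fun do under eq_bigr do rewrite expr1n mulr1.
suff -> : (vre 1 +i* vim 1)%C = half_plane_power (1 - x) (- l) by [].
have pE : (pre 1 +i* pim 1)%C = half_plane_power (1 - x) l.
  by rewrite -half_plane_power_ray ?X_gt0// mul1r -xE.
rewrite pE in key.
have q : half_plane_power (1 - x) l * half_plane_power (1 - x) (- l) = 1.
  by apply: half_plane_power_mulN; have := X_gt0 n1; rewrite mul1r xE.
have pn : half_plane_power (1 - x) l != 0.
  by apply/eqP => e; move/eqP: q; rewrite e mul0r eq_sym oner_eq0.
by apply: (mulfI pn); rewrite key q.
Qed.

End BinomialTheorem.

Section HilbertSpace.
Variables (R : realType) (X : Type).
Local Notation C := R[i].
Variable H : hilbert_space_of_functions R X.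
Implicit Types (f g h : X -> C) (a : C).

Lemma carrierZ a f : carrier H f -> carrier H (a *: f).
Proof. by move=> Hf; rewrite -[_ *: _]addr0; apply: carrier_lin => //; exact: carrier0. Qed.

Lemma carrierD f g : carrier H f -> carrier H g -> carrier H (f + g).
Proof. by move=> Hf Hg; rewrite -[f]scale1r; exact: carrier_lin. Qed.

Lemma carrierB f g : carrier H f -> carrier H g -> carrier H (f - g).
Proof. by move=> Hf Hg; rewrite addrC -scaleN1r; exact: carrier_lin. Qed.

Lemma carrier_sum (I : Type) (r : seq I) (P : pred I) (F : I -> X -> C) :
  (forall i, P i -> carrier H (F i)) -> carrier H (\sum_(i <- r | P i) F i).
Proof. by move=> HF; apply: big_ind HF => [|f g]; [exact: carrier0 | exact: carrierD]. Qed.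

Lemma dotpDl f g h : carrier H f -> carrier H g -> carrier H h ->
  dotp H (f + g) h = dotp H f h + dotp H g h.
Proof. by move=> Hf Hg Hh; rewrite -[f]scale1r dotp_lin// mul1r scale1r. Qed.

Lemma dotp0l h : carrier H h -> dotp H 0 h = 0.
Proof.
move=> Hh; have H0 := carrier0 H; have := dotpDl H0 H0 Hh.
by rewrite addr0 => /eqP; rewrite -subr_eq0 opprD addNKr oppr_eq0 => /eqP.
Qed.

Lemma dotpZl a f h : carrier H f -> carrier H h ->
  dotp H (a *: f) h = a * dotp H f h.
Proof.
move=> Hf Hh; have := dotp_lin a Hf (carrier0 H) Hh.
by rewrite addr0 dotp0l ?addr0.
Qed.

Lemma dotpBl f g h : carrier H f -> carrier H g -> carrier H h ->
  dotp H (f - g) h = dotp H f h - dotp H g h.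
Proof.
by move=> Hf Hg Hh; rewrite addrC -scaleN1r dotp_lin// mulN1r addrC.
Qed.

Lemma dotp_suml (I : Type) (r : seq I) (P : pred I) (F : I -> X -> C) h :
  (forall i, P i -> carrier H (F i)) -> carrier H h ->
  dotp H (\sum_(i <- r | P i) F i) h = \sum_(i <- r | P i) dotp H (F i) h.
Proof.
move=> HF Hh; elim: r => [|i r IH]; first by rewrite !big_nil dotp0l.
rewrite !big_cons; case: ifP => // Pi.
by rewrite dotpDl ?IH//; [exact: HF | exact: carrier_sum].
Qed.

Lemma dotpZr a f h : carrier H f -> carrier H h ->
  dotp H h (a *: f) = a^* * dotp H h f.
Proof.
by move=> Hf Hh; rewrite (dotp_conj (carrierZ a Hf) Hh) dotpZl// rmorphM /= -dotp_conj.
Qed.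

Lemma dotpBr f g h : carrier H f -> carrier H g -> carrier H h ->
  dotp H h (f - g) = dotp H h f - dotp H h g.
Proof.
move=> Hf Hg Hh; rewrite (dotp_conj (carrierB Hf Hg) Hh) dotpBl// rmorphB /=.
by rewrite -!dotp_conj.
Qed.

Lemma dotp_sumr (I : Type) (r : seq I) (P : pred I) (F : I -> X -> C) h :
  (forall i, P i -> carrier H (F i)) -> carrier H h ->
  dotp H h (\sum_(i <- r | P i) F i) = \sum_(i <- r | P i) dotp H h (F i).
Proof.
move=> HF Hh; rewrite (dotp_conj (carrier_sum r HF) Hh) dotp_suml// rmorph_sum /=.
by apply: eq_bigr => i Pi; rewrite -dotp_conj//; exact: HF.
Qed.

Lemma dotp_ge0 f : carrier H f -> 0 <= dotp H f f.
Proof.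
move=> Hf; have [->|f0] := eqVneq f 0; first by rewrite dotp0l//; exact: carrier0.
by rewrite ltW// dotp_gt0.
Qed.

Lemma cauchy_schwarz f g : carrier H f -> carrier H g ->
  `|dotp H f g| ^+ 2 <= dotp H f f * dotp H g g.
Proof.
move=> Hf Hg; have [->|g0] := eqVneq g 0.
  rewrite (dotp_conj (carrier0 H) Hf).
  by rewrite !dotp0l ?rmorph0 ?normr0 ?mulr0 ?expr0n//; exact: carrier0.
have gg := dotp_gt0 Hg g0; have ggn : dotp H g g != 0 by rewrite gt_eqF.
pose c := dotp H f g / dotp H g g; have Hcg := carrierZ c Hg.
have Hh := carrierB Hf Hcg; have := dotp_ge0 Hh.
have orth : dotp H (f - c *: g) g = 0.
  by rewrite dotpBl// dotpZl// /c divfK// subrr.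
rewrite dotpBr// [X in _ - X]dotpZr// orth mulr0 subr0 dotpBl// dotpZl//.
rewrite subr_ge0 /c mulrAC ler_pdivrMr// [in X in _ * X](dotp_conj Hf Hg).
by rewrite normCK.
Qed.

Definition hnorm f : R := Num.sqrt (complex.Re (dotp H f f)).

Lemma hnorm_ge0 f : 0 <= hnorm f. Proof. exact: sqrtr_ge0. Qed.

Lemma dotp_hnorm f : carrier H f -> dotp H f f = (hnorm f ^+ 2)%:C%C.
Proof.
move=> /dotp_ge0 ff; have fR := RRe_real (ger0_real ff).
by rewrite sqr_sqrtr ?fR// -ler0c fR.
Qed.

Lemma norm_dotp f g : carrier H f -> carrier H g ->
  `|dotp H f g| <= (hnorm f * hnorm g)%:C%C.
Proof.
move=> Hf Hg.
have p : 0 <= (hnorm f * hnorm g)%:C%C :> C by rewrite ler0c mulr_ge0 ?hnorm_ge0.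
rewrite -(@ler_pXn2r _ 2) ?nnegrE// (le_trans (cauchy_schwarz Hf Hg))//.
by rewrite !dotp_hnorm// -rmorphM -rmorphXn exprMn.
Qed.

(* Strong convergence, but only its weak consequence is recorded. *)
Lemma hilbert_limit (e : nat -> X -> C) (L : C) :
  (forall k, carrier H (e k)) ->
  (forall d : C, 0 < d -> exists N : nat, forall j k : nat,
     (N <= j)%N -> (N <= k)%N -> `|dotp H (e j) (e k) - L| < d) ->
  exists2 F, carrier H F &
    forall f, carrier H f -> tends_to (fun k => dotp H f (e k)) (dotp H f F).
Proof.
move=> He eL.
have [d d0|F HF lim] := carrier_complete He.
  have d4 : 0 < (d ^+ 2 / 4)%:C%C :> C by rewrite ltcR divr_gt0// exprn_gt0.
  have [N HN] := eL _ d4; exists N => j k Nj Nk.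
  rewrite -/(hnorm _) -(@ltr_pXn2r _ 2) ?nnegrE ?hnorm_ge0 ?(ltW d0)//.
  have Hjk := carrierB (He j) (He k).
  rewrite -ltcR -dotp_hnorm//; apply: le_lt_trans (real_ler_norm _) _.
    exact: ger0_real (dotp_ge0 Hjk).
  rewrite dotpBl// !dotpBr//.
  have -> (p q r s : C) : p - q - (r - s) = (p - L) - (q - L) - ((r - L) - (s - L)).
    by ring.
  have -> : (d ^+ 2)%:C%C = (d ^+ 2 / 4)%:C%C + (d ^+ 2 / 4)%:C%C +
      ((d ^+ 2 / 4)%:C%C + (d ^+ 2 / 4)%:C%C) :> C.
    by rewrite -!rmorphD; congr (_%:C%C); field.
  apply: le_lt_trans (ler_normB _ _) _; apply: ltrD;
    by apply: le_lt_trans (ler_normB _ _) _; apply: ltrD; exact: HN.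
exists F => // f Hf; apply/tends_toP => _ /gt0_complex[d d0 ->].
have f1 : 0 < hnorm f + 1 by rewrite ltr_wpDl ?hnorm_ge0.
have [|N HN] := lim (d / (hnorm f + 1)); first by rewrite divr_gt0.
exists N => k /HN; rewrite -/(hnorm _) ltr_pdivlMr// => Hk.
rewrite -dotpBr//; apply: le_lt_trans (norm_dotp Hf (carrierB (He k) HF)) _.
rewrite ltcR mulrC; apply: le_lt_trans Hk.
by apply: ler_wpM2l; rewrite ?hnorm_ge0 ?lerDl.
Qed.

End HilbertSpace.

Section RootsOfUnity.
Variable R : realType.
Local Notation C := R[i].

Lemma primitive_root_exists N : exists z : C, N.+1.-primitive_root z.
Proof.
pose p : {poly C} := ('X^(N.+1) - 1)%R; have [rs Dp] := closed_field_poly_normal p.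
rewrite (monicP _) ?monicXnsubC// scale1r in Dp.
have rs1 : all N.+1.-unity_root rs by apply/allP => z; rewrite -root_prod_XsubC -Dp.
have sz : (N.+1 <= size rs)%N.
  by rewrite -ltnS -(size_prod_XsubC rs id) -Dp size_XnsubC.
have [|z _ zP] := hasP (has_prim_root (ltn0Sn N) rs1 _ sz); last by exists z.
by rewrite -separable_prod_XsubC -Dp separable_Xn_sub_1// pnatr_eq0.
Qed.

Definition omega N : C := sval (cid (primitive_root_exists N)).

Lemma omega_prim N : N.+1.-primitive_root (omega N).
Proof. exact: svalP (cid (primitive_root_exists N)). Qed.

Lemma norm_omegaX N m : `|omega N ^+ m| = 1.
Proof.
rewrite normrX; suff -> : `|omega N| = 1 by rewrite expr1n.
apply/eqP; rewrite -(@pexpr_eq1 _ _ N.+1)//.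
by rewrite -normrX prim_expr_order ?omega_prim// normr1.
Qed.

Lemma omegaX_conj N m : omega N ^+ m * (omega N ^+ m)^* = 1.
Proof. by rewrite -normCK norm_omegaX expr1n. Qed.

Definition mean N (F : 'I_N.+1 -> C) : C := \sum_l N.+1%:R^-1 * F l.

Lemma mean_omega N m p :
  mean (fun l : 'I_N.+1 => (omega N ^+ (l * m))^* * omega N ^+ (l * p))
    = (m == p %[mod N.+1])%:R.
Proof.
pose z := (omega N ^+ m)^* * omega N ^+ p.
have zX l : (omega N ^+ (l * m))^* * omega N ^+ (l * p) = z ^+ l.
  by rewrite exprMn -rmorphXn -!exprM ![(_ * l)%N]mulnC.
rewrite /mean -mulr_sumr; under eq_bigr do rewrite zX.
have zm : omega N ^+ m * z = omega N ^+ p by rewrite mulrA omegaX_conj mul1r.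
have N0 : N.+1%:R != 0 :> C by rewrite pnatr_eq0.
have -> : (m == p %[mod N.+1]) = (z == 1).
  rewrite -(eq_prim_root_expr (omega_prim N)).
  have w0 : omega N ^+ m != 0 by rewrite -normr_eq0 norm_omegaX oner_eq0.
  by rewrite -(inj_eq (mulfI w0) z 1) mulr1 zm eq_sym.
have [->|z1] := eqVneq z 1.
  under eq_bigr do rewrite expr1n.
  by rewrite sumr_const card_ord mulVf.
suff -> : \sum_(l < N.+1) z ^+ l = 0 by rewrite mulr0.
have z10 : z - 1 != 0 by rewrite subr_eq0.
have wN q : (omega N ^+ q) ^+ N.+1 = 1.
  by rewrite -exprM mulnC exprM (prim_expr_order (omega_prim N)) expr1n.
by apply: (mulfI z10); rewrite mulr0 -subrX1 exprMn -rmorphXn /= !wN rmorph1 mulr1 subrr.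
Qed.

Lemma mean_dist N (F G : 'I_N.+1 -> C) (b : C) :
  (forall l, `|F l - G l| <= b) -> `|mean F - mean G| <= b.
Proof.
move=> FG; rewrite /mean -sumrB; apply: le_trans (ler_norm_sum _ _ _) _.
have N0 : 0 < N.+1%:R :> C by rewrite ltr0n.
have -> : b = \sum_(l < N.+1) N.+1%:R^-1 * b.
  by rewrite sumr_const card_ord -mulrnAl -[X in X * b]mulr_natr mulVf ?mul1r// gt_eqF.
apply: ler_sum => l _; rewrite -mulrBr normrM ger0_norm; last by rewrite invr_ge0 ltW.
by apply: ler_wpM2l; rewrite ?invr_ge0// ltW.
Qed.

End RootsOfUnity.

Section OneVariable.
Variables (R : realType).
Local Notation C := R[i].
Variables (k : C -> C) (a : nat -> C).
Hypothesis a_gt0 : forall m, 0 < a m.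
Let s N x := \sum_(m < N) a m * x ^+ m.
Hypothesis series : forall x : C, `|x| < 1 -> tends_to (s ^~ x) (k x).

Definition tail N (x : C) : C := `|k `|x| - s N `|x| |.

Lemma tail_tends_to0 x : `|x| < 1 -> tends_to (tail ^~ x) 0.
Proof.
move=> x1; rewrite -(normr0 C) -(subrr (k `|x|)); apply: tends_to_norm.
apply: tends_toB; first exact: tends_to_cst.
by apply: series; rewrite normr_id.
Qed.

Lemma partial_sum_dist N x : `|x| < 1 -> `|k x - s N x| <= tail N x.
Proof.
move=> x1.
have drop y M : s (M + N) y - s N y = \sum_(m < M) a (N + m) * y ^+ (N + m).
  by rewrite /s addnC big_split_ord /= [LHS]addrC addKr.
have lim y : `|y| < 1 -> tends_to (fun M => s (M + N) y - s N y) (k y - s N y).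
  move=> y1; apply: tends_toB; last exact: tends_to_cst.
  elim: N {drop} => [|P IH]; first by under eq_fun do rewrite addn0; exact: series.
  by under eq_fun do rewrite addnS -addSn; exact: (tends_to_comp_shift IH).
apply: tends_to_le_norm (lim _ x1) (lim `|x| _) _; first by rewrite normr_id.
move=> M; rewrite !drop; apply: le_trans (ler_norm_sum _ _ _) _.
have -> : \sum_(m < M) `|a (N + m) * x ^+ (N + m)| =
          \sum_(m < M) a (N + m) * `|x| ^+ (N + m).
  by apply: eq_bigr => m _; rewrite normrM normrX gtr0_norm.
by apply: real_ler_norm; apply: rpred_sum => m _;
  rewrite rpredM ?rpredX ?normr_real// gtr0_real.
Qed.

(* [phi N m x] approximates [a m * x ^+ m]: averaging over the roots of unity
   keeps the terms whose exponent is congruent to m modulo N.+1. *)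
Definition phi N m x : C :=
  mean (fun l : 'I_N.+1 => omega R N ^+ (l * m) * k (x * (omega R N ^+ l)^*)).

Lemma phi_dist N m x : (m <= N)%N -> `|x| < 1 ->
  `|phi N m x - a m * x ^+ m| <= tail N.+1 x.
Proof.
move=> mN x1.
have -> : a m * x ^+ m =
    mean (fun l : 'I_N.+1 => omega R N ^+ (l * m) * s N.+1 (x * (omega R N ^+ l)^*)).
  rewrite /mean; under eq_bigr do rewrite !mulr_sumr.
  rewrite exchange_big /= (bigD1 (Ordinal (mN : (m < N.+1)%N)))//= [X in _ + X]big1.
    have := @mean_omega R N m m; rewrite eqxx /mean addr0 => e.
    rewrite -[LHS]mulr1 -[X in _ * X]e mulr_sumr; apply: eq_bigr => l _.
    by rewrite exprMn -rmorphXn -exprM; ring.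
  move=> p pm; have := @mean_omega R N p m; rewrite /mean.
  rewrite !modn_small// (_ : (p == m :> nat) = false); last exact: negbTE.
  move=> e; rewrite -[RHS](mulr0 (a p * x ^+ p)) -[X in _ = _ * X]e mulr_sumr.
  by apply: eq_bigr => l _; rewrite exprMn -rmorphXn -exprM; ring.
apply: mean_dist => l; rewrite -mulrBr normrM norm_omegaX mul1r.
have e : `|x * (omega R N ^+ l)^*| = `|x| by rewrite normrM norm_conjC norm_omegaX mulr1.
by apply: le_trans (partial_sum_dist _ _) _; rewrite /tail e.
Qed.

Definition psi N M m q : C :=
  mean (fun l : 'I_N.+1 => (omega R N ^+ (l * m))^* * phi M m (q * omega R N ^+ l)).

Lemma psi_dist N M m q : (m <= M)%N -> `|q| < 1 ->
  `|psi N M m q - a m * q ^+ m| <= tail M.+1 q.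
Proof.
move=> mM q1.
have -> : a m * q ^+ m = mean (fun l : 'I_N.+1 =>
    (omega R N ^+ (l * m))^* * (a m * (q * omega R N ^+ l) ^+ m)).
  have := @mean_omega R N m m; rewrite eqxx /mean => e.
  rewrite -[LHS]mulr1 -[X in _ * X]e mulr_sumr; apply: eq_bigr => l _.
  by rewrite exprMn -exprM; ring.
apply: mean_dist => l; rewrite -mulrBr normrM norm_conjC norm_omegaX mul1r.
have e : `|q * omega R N ^+ l| = `|q| by rewrite normrM norm_omegaX mulr1.
by apply: le_trans (phi_dist mM _) _; rewrite /tail e.
Qed.

Lemma psi_tends_to m q : `|q| < 1 ->
  tends_to (fun N => psi N N m q) (a m * q ^+ m).
Proof.
move=> q1; apply: tends_to_squeeze (tends_to_comp_shift (tail_tends_to0 q1)).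
by exists m => N mN; exact: psi_dist.
Qed.

Lemma psi_high_tends_to0 c q : (0 < c)%N -> `|q| < 1 ->
  tends_to (fun N => psi N N (N.+1 - c) q) 0.
Proof.
move=> c0 q1.
have term0 : tends_to (fun m => a m * q ^+ m) 0.
  have := tends_toB (tends_to_comp_shift (series q1)) (series q1).
  by rewrite subrr /s; under eq_fun do rewrite big_ord_recr /= [X in X - _]addrC addrK.
apply: (@tends_to_eq_near _ (fun N => (psi N N (N.+1 - c) q -
    a (N.+1 - c)%N * q ^+ (N.+1 - c)) + a (N.+1 - c)%N * q ^+ (N.+1 - c))).
  by exists 0%N => N _; rewrite subrK.
rewrite -[0]addr0; apply: tends_toD.
  apply: tends_to_squeeze (tends_to_comp_shift (tail_tends_to0 q1)).
  by exists 0%N => N _; rewrite subr0 psi_dist// leq_subLR -addn1 addnC leq_add2r.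
move/tends_toP: term0 => t; apply/tends_toP => e /t[N HN].
by exists (N + c)%N => p Np; apply: HN; rewrite leq_subRL; lia.
Qed.

End OneVariable.

Section ProductPerturbation.

Lemma prod_perturb (K : numFieldType) (I : Type) (rs : seq I) (L : I -> K) :
  exists2 c : K, 0 <= c & forall (e : K) (y : I -> K), 0 <= e <= 1 ->
    (forall i, `|y i - L i| <= e) ->
    `|\prod_(i <- rs) y i - \prod_(i <- rs) L i| <= c * e.
Proof.
elim: rs => [|i rs [c c0 IH]].
  by exists 0 => // e y _ _; rewrite !big_nil subrr normr0 mul0r.
set Q := \prod_(j <- rs) L j in IH *.
exists (`|Q| + c + `|L i| * c); first by rewrite !addr_ge0// mulr_ge0.
move=> e y e01 ye; have /andP[e0 e1] := e01; rewrite !big_cons.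
set P := \prod_(j <- rs) y j; have PQ : `|P - Q| <= c * e by exact: IH.
have -> : y i * P - L i * Q = (y i - L i) * P + L i * (P - Q) by ring.
apply: le_trans (ler_normD _ _) _; rewrite [leRHS]mulrDl !normrM; apply: lerD.
  rewrite [leRHS]mulrC; apply: ler_pM => //.
  rewrite -[P](subrK Q) addrC; apply: le_trans (ler_normD _ _) _.
  by rewrite lerD2l; apply: le_trans PQ _; rewrite ler_piMr.
by rewrite -mulrA ler_wpM2l.
Qed.

End ProductPerturbation.

Section Monomials.
Variables (R : realType) (n : nat).
Local Notation C := R[i].
Implicit Types (m p : 'I_n -> nat) (z w : polydisc R n).

Definition mono m : polydisc R n -> C := fun z => \prod_j val z 0 j ^+ m j.

Variable H : hilbert_space_of_functions R (polydisc R n).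
Variables (k : C -> C) (a : nat -> C).
Hypothesis a_gt0 : forall i, 0 < a i.
Hypothesis series : forall x : C, `|x| < 1 ->
  tends_to (fun N => \sum_(i < N) a i * x ^+ i) (k x).
Let K z w : C := \prod_j k (val z 0 j * (val w 0 j)^*).
Hypothesis repK : reproducing_kernel H K.

Let carrierK w : carrier H (K ^~ w). Proof. exact: (repK w).1. Qed.
Let dotpK f w : carrier H f -> dotp H f (K ^~ w) = f w.
Proof. exact: (repK w).2. Qed.

Lemma polydisc_norm z j : `|val z 0 j| < 1.
Proof. exact: (set_valP z). Qed.

Variable r : C.
Hypotheses (r_gt0 : 0 < r) (r_lt1 : r < 1).

Let r_conj : r^* = r.
Proof. by apply/CrealP; exact: gtr0_real. Qed.

Let norm_r : `|r| < 1. Proof. by rewrite gtr0_norm. Qed.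

Let q := r * r.
Let norm_q : `|q| < 1.
Proof. by rewrite normrM mulr_ilt1. Qed.

Definition grid_row N (J : {ffun 'I_n -> 'I_N.+1}) : 'rV[C]_n :=
  \row_j (r * omega R N ^+ J j).

Lemma grid_row_polydisc N (J : {ffun 'I_n -> 'I_N.+1}) :
  grid_row J \in polydisc R n.
Proof. by apply/mem_set => j; rewrite mxE normrM norm_omegaX mulr1. Qed.

Definition grid N (J : {ffun 'I_n -> 'I_N.+1}) : polydisc R n :=
  SigSub (grid_row_polydisc J).

Lemma gridE N (J : {ffun 'I_n -> 'I_N.+1}) j :
  val (grid J) 0 j = r * omega R N ^+ J j.
Proof. by rewrite mxE. Qed.

Definition grid_kernel N m : polydisc R n -> C :=
  \sum_(J : {ffun 'I_n -> 'I_N.+1})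
    (\prod_j (N.+1%:R^-1 * omega R N ^+ (J j * m j))) *: (K ^~ (grid J)).

Definition avg N m (f : polydisc R n -> C) : C :=
  \sum_(J : {ffun 'I_n -> 'I_N.+1})
    (\prod_j (N.+1%:R^-1 * (omega R N ^+ (J j * m j))^*)) * f (grid J).

Lemma carrier_grid_kernel N m : carrier H (grid_kernel N m).
Proof. by apply: carrier_sum => J _; apply: carrierZ; exact: carrierK. Qed.

Lemma dotp_grid_kernel N m f : carrier H f -> dotp H f (grid_kernel N m) = avg N m f.
Proof.
move=> Hf; rewrite dotp_sumr//; last by move=> J _; apply: carrierZ; exact: carrierK.
apply: eq_bigr => J _; rewrite dotpZr// dotpK// rmorph_prod; congr (_ * _).
by apply: eq_bigr => j _; rewrite rmorphM fmorphV rmorph_nat.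
Qed.

Let sum_ffun_prod N (F : 'I_n -> 'I_N.+1 -> C) :
  \sum_(J : {ffun 'I_n -> 'I_N.+1}) \prod_j F j (J j) = \prod_j \sum_l F j l.
Proof. by rewrite bigA_distr_bigA. Qed.

Lemma grid_kernelE N m z :
  grid_kernel N m z = \prod_j phi k N (m j) (r * val z 0 j).
Proof.
rewrite /grid_kernel fct_sumE /phi /mean -sum_ffun_prod.
apply: eq_bigr => J _; rewrite -[LHS]/(_ * K z (grid J)) -big_split /=.
apply: eq_bigr => j _; rewrite gridE rmorphM /= r_conj [RHS]mulrA.
by congr (_ * k _); ring.
Qed.

Lemma avg_grid_kernel N M m :
  avg N m (grid_kernel M m) = \prod_j psi k N M (m j) q.
Proof.
rewrite /psi /mean -sum_ffun_prod.
apply: eq_bigr => J _; rewrite grid_kernelE -big_split /=.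
by apply: eq_bigr => j _; rewrite gridE mulrA -!mulrA.
Qed.

Lemma avg_mono N m p :
  avg N m (mono p) = \prod_j (r ^+ p j * (m j == p j %[mod N.+1])%:R).
Proof.
under [RHS]eq_bigr do rewrite -mean_omega /mean mulr_sumr.
rewrite -sum_ffun_prod; apply: eq_bigr => J _; rewrite -big_split /=.
apply: eq_bigr => j _; rewrite gridE exprMn -exprM; ring.
Qed.

Lemma avg_mono_mul N m p s (f : polydisc R n -> C) :
  (forall j, s j + p j = m j %[mod N.+1]) ->
  avg N m (mono p * f) = (\prod_j r ^+ p j) * avg N s f.
Proof.
move=> smp; rewrite mulr_sumr; apply: eq_bigr => J _.
rewrite -[(mono p * f) _]/(mono p (grid J) * f (grid J)) !mulrA; congr (_ * _).
rewrite /mono -!big_split /=; apply: eq_bigr => j _; rewrite gridE.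
have -> : omega R N ^+ (J j * m j) = omega R N ^+ (J j * s j) * omega R N ^+ (J j * p j).
  rewrite -exprD -mulnDr ![(J j * _)%N]mulnC !exprM; congr (_ ^+ _).
  by apply/eqP; rewrite (eq_prim_root_expr (omega_prim R N)) smp.
have := omegaX_conj R N (J j * p j); rewrite rmorphM exprMn -exprM => e.
rewrite -[RHS]mulr1 -[X in _ = _ * X]e; ring.
Qed.

Definition weight m : C := \prod_j (a (m j) * r ^+ m j).

Lemma weight_gt0 m : 0 < weight m.
Proof. by apply: prodr_gt0 => j _; rewrite mulr_gt0// exprn_gt0. Qed.

Let tail_lt (d : C) : 0 < d -> exists N, forall M, (N <= M)%N -> tail k a M.+1 q < d.
Proof.
move=> d0; have /tends_toP/(_ d d0)[N HN] :=
  tends_to_comp_shift (tail_tends_to0 series norm_q).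
exists N => M /HN; rewrite subr0 ger0_norm//; exact: normr_ge0.
Qed.

Lemma mono_coefficient m : carrier H (mono m) /\
  forall f, carrier H f -> tends_to (fun N => avg N m f) (weight m * dotp H f (mono m)).
Proof.
have [|d d0|F HF limF] := @hilbert_limit _ _ H (fun N => grid_kernel N m)
    (\prod_j (a (m j) * q ^+ m j)).
- by move=> N; exact: carrier_grid_kernel.
- have [c c0 Hc] := prod_perturb (index_enum 'I_n) (fun j => a (m j) * q ^+ m j).
  have c1 : 0 < c + 1 by rewrite ltr_wpDl.
  have [N1 HN1] := tail_lt ltr01.
  have [N2 HN2] := tail_lt (divr_gt0 d0 c1).
  exists (maxn (maxn N1 N2) (\sum_j m j)) => i j Hi _.
  rewrite dotp_grid_kernel; last exact: carrier_grid_kernel.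
  rewrite avg_grid_kernel; apply: le_lt_trans (Hc (tail k a i.+1 q) _ _ _) _.
  + by rewrite normr_ge0 ltW// HN1//; lia.
  + move=> l; apply: (psi_dist a_gt0 series) => //.
    apply: leq_trans (leq_trans _ Hi); last exact: leq_maxr.
    by rewrite (bigD1 l)//= leq_addr.
  + have : tail k a i.+1 q < d / (c + 1) by apply: HN2; lia.
    rewrite ltr_pdivlMr// mulrC; apply: le_lt_trans.
    by apply: ler_wpM2r; [exact: normr_ge0 | rewrite lerDl].
have FE : F = weight m *: mono m.
  apply/funext => z; rewrite -[RHS]/(weight m * mono m z).
  apply: (@tends_to_unique _ (fun N => grid_kernel N m z)).
    have := limF _ (carrierK z) => /tends_toP l.
    apply/tends_toP => e /l[N HN]; exists N => M /HN.
    rewrite -norm_conjC rmorphB /= -!dotp_conj// ?dotpK//; exact: carrier_grid_kernel.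
  under eq_fun do rewrite grid_kernelE.
  rewrite /weight /mono -big_split /=; apply: tends_to_prod => j _.
  rewrite -mulrA -exprMn.
  have x1 : `|r * val z 0 j| < 1 by rewrite normrM mulr_ilt1// polydisc_norm.
  apply: tends_to_squeeze (tends_to_comp_shift (tail_tends_to0 series x1)).
  by exists (m j) => N mN; exact: (phi_dist a_gt0 series).
have w0 : weight m != 0 by rewrite gt_eqF ?weight_gt0.
have Hm : carrier H (mono m).
  by rewrite -[mono m]scale1r -(mulVf w0) -scalerA -FE; exact: carrierZ.
split; first exact: Hm.
move=> f Hf; have := limF f Hf; rewrite FE (dotpZr _ Hm Hf).
have /CrealP -> : weight m \is Num.real by rewrite gtr0_real ?weight_gt0.
by under eq_fun do rewrite (dotp_grid_kernel _ _ Hf).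
Qed.

Lemma carrier_mono m : carrier H (mono m).
Proof. exact: (mono_coefficient m).1. Qed.

Lemma avg_tends_to m f : carrier H f ->
  tends_to (fun N => avg N m f) (weight m * dotp H f (mono m)).
Proof. exact: (mono_coefficient m).2. Qed.

Lemma dotp_mono m p :
  dotp H (mono p) (mono m) = [forall j, m j == p j]%:R / \prod_j a (m j).
Proof.
have w0 : weight m != 0 by rewrite gt_eqF ?weight_gt0.
have lim := @avg_tends_to m _ (carrier_mono p).
apply: (mulfI w0); apply: (tends_to_unique lim).
apply: (@tends_to_eq_near _ (fun=> \prod_j (r ^+ p j * (m j == p j)%:R))).
  exists (\sum_j (m j + p j))%N => N HN; rewrite avg_mono; apply: eq_bigr => j _.
  have : (m j + p j <= N)%N by apply: leq_trans HN; rewrite (bigD1 j)//= leq_addr.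
  by move=> mpN; rewrite !modn_small//; lia.
suff -> : weight m * ([forall j, m j == p j]%:R / \prod_j a (m j)) =
    \prod_j (r ^+ p j * (m j == p j)%:R) by exact: tends_to_cst.
case: forallP => [mp|/forallP]; last first.
  rewrite negb_forall => /existsP[j /negbTE mp].
  by rewrite mul0r mulr0 (bigD1 j)//= mp mulr0 mul0r.
rewrite /weight big_split /= mul1r mulrAC mulfV ?mul1r.
  by apply: eq_bigr => j _; rewrite mp mulr1 (eqP (mp j)).
by apply/prodf_neq0 => j _; rewrite gt_eqF.
Qed.

Lemma mono_total f : carrier H f -> (forall m, dotp H f (mono m) = 0) -> f = 0.
Proof.
move=> Hf f0; apply/funext => w; rewrite -[RHS]/(0 : C).
pose P N : polydisc R n -> C := \sum_(J : {ffun 'I_n -> 'I_N})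
  (\prod_j (a (J j) * (val w 0 j ^+ J j)^*)) *: mono (fun j => J j).
have HT N (J : {ffun 'I_n -> 'I_N}) : true -> carrier H
    ((\prod_j (a (J j) * (val w 0 j ^+ J j)^*)) *: mono (fun j => J j)).
  by move=> _; apply: carrierZ; exact: carrier_mono.
have HP N : carrier H (P N) by apply: carrier_sum => J _; exact: HT.
have HD N : carrier H (K ^~ w - P N) by apply: carrierB; [exact: carrierK | exact: HP].
have orth N : dotp H (K ^~ w - P N) (P N) = 0.
  rewrite {2}/P (dotp_sumr _ (@HT N) (HD N)); apply: big1 => J _.
  rewrite (dotpZr _ (carrier_mono _) (HD N)).
  rewrite (dotpBl (carrierK w) (HP N) (carrier_mono _)).
  rewrite (dotp_conj (carrier_mono _) (carrierK w)) (dotpK w (carrier_mono _)).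
  rewrite /P (dotp_suml _ (@HT N) (carrier_mono _)).
  rewrite (bigD1 J)//= [X in _ - (_ + X)]big1 ?addr0.
    rewrite (dotpZl _ (carrier_mono _) (carrier_mono _)).
    rewrite dotp_mono (_ : [forall j, _]); last by apply/forallP.
    rewrite mul1r big_split /= mulrAC mulfV ?mul1r.
      by rewrite /mono rmorph_prod subrr mulr0.
    by apply/prodf_neq0 => j _; rewrite gt_eqF.
  move=> J' J'J; rewrite (dotpZl _ (carrier_mono _) (carrier_mono _)).
  rewrite dotp_mono (_ : [forall j, _] = false) ?mul0r ?mulr0//.
  apply/negbTE; apply: contra J'J => /forallP JJ.
  by apply/eqP/ffunP => j; apply/val_inj/esym/eqP; exact: JJ.
pose g N := dotp H f f * (\prod_j k (val w 0 j * (val w 0 j)^*) - P N w).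
have bound N : `|f w| ^+ 2 <= g N.
  have -> : f w = dotp H f (K ^~ w - P N).
    rewrite (dotpBr (carrierK w) (HP N) Hf) (dotpK w Hf).
    rewrite /P (dotp_sumr _ (@HT N) Hf) big1 ?subr0// => J _.
    by rewrite (dotpZr _ (carrier_mono _) Hf) f0 mulr0.
  apply: le_trans (cauchy_schwarz Hf (HD N)) _; rewrite /g.
  by rewrite (dotpBr (carrierK w) (HP N) (HD N)) orth subr0 (dotpK w (HD N)).
have PE N : P N w = \prod_j \sum_(l < N) a l * (val w 0 j * (val w 0 j)^*) ^+ l.
  rewrite bigA_distr_bigA /P fct_sumE; apply: eq_bigr => J _.
  rewrite -[LHS]/(_ * mono _ w) -big_split /=; apply: eq_bigr => j _.
  by rewrite rmorphXn exprMn /=; ring.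
pose A := \prod_j k (val w 0 j * (val w 0 j)^*).
have PA : tends_to (fun N => P N w) A.
  under eq_fun do rewrite PE; apply: tends_to_prod => j _; apply: series.
  by rewrite -normCK normrX normr_id expr_lt1// polydisc_norm.
have g0 : tends_to g 0.
  have := tends_toM (@tends_to_cst _ (dotp H f f)) (tends_toB (@tends_to_cst _ A) PA).
  by rewrite subrr mulr0.
have : tends_to (fun=> `|f w| ^+ 2) (0 : C).
  apply: tends_to_squeeze g0; exists 0%N => N _.
  by rewrite subr0 ger0_norm ?exprn_ge0.
move=> fw0; have /eqP := tends_to_unique (@tends_to_cst _ (`|f w| ^+ 2)) fw0.
by rewrite expf_eq0 /= normr_eq0 => /eqP.
Qed.

Lemma avg_high_tends_to0 m p f : carrier H f -> (exists j, (m j < p j)%N) ->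
  tends_to (fun N => avg N
    (fun j => if (p j <= m j)%N then (m j - p j)%N else (N.+1 - (p j - m j))%N) f) 0.
Proof.
move=> Hf [j0 mp].
pose s N j := if (p j <= m j)%N then (m j - p j)%N else (N.+1 - (p j - m j))%N.
pose L j := if (p j <= m j)%N then a (m j - p j) * q ^+ (m j - p j) else 0.
have lim : tends_to (fun N => dotp H f f * \prod_j psi k N N (s N j) q) 0.
  rewrite -[0](mulr0 (dotp H f f)); apply: tends_toM; first exact: tends_to_cst.
  have -> : 0 = \prod_j L j by rewrite (bigD1 j0)//= /L leqNgt mp mul0r.
  apply: tends_to_prod => j _; rewrite /s /L; case: leqP => pm.
    exact: (psi_tends_to a_gt0 series).
  by apply: (psi_high_tends_to0 a_gt0 series) => //; rewrite subn_gt0.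
apply/tends_toP => e e0; have /tends_toP/(_ (e ^+ 2)) := lim.
rewrite exprn_gt0// => /(_ isT)[N HN]; exists N => M /HN; rewrite !subr0 => HM.
rewrite -(@ltr_pXn2r _ 2) ?nnegrE ?(ltW e0)//; apply: le_lt_trans HM.
rewrite -dotp_grid_kernel//; apply: le_trans (cauchy_schwarz Hf (carrier_grid_kernel M _)) _.
rewrite (dotp_grid_kernel _ _ (carrier_grid_kernel M _)) avg_grid_kernel.
apply: real_ler_norm; rewrite rpredM//; first exact: ger0_real (dotp_ge0 Hf).
rewrite -avg_grid_kernel -dotp_grid_kernel; last exact: carrier_grid_kernel.
exact: ger0_real (dotp_ge0 (carrier_grid_kernel M _)).
Qed.

End Monomials.

Section Permutations.
Variables (R : realType) (n : nat).
Local Notation C := R[i].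
Implicit Types (m p : 'I_n -> nat) (s t : 'S_n) (f g : polydisc R n -> C).

Lemma perm_actE s (z : polydisc R n) j : val (perm_act s^-1%g z) 0 j = val z 0 (s j).
Proof. by rewrite mxE invgK. Qed.

Lemma mono_perm m s : comp_perm_inv (mono m : polydisc R n -> C) s = mono (m \o s^-1%g).
Proof.
apply/funext => z; rewrite /comp_perm_inv /mono [RHS](reindex_inj (@perm_inj _ s)) /=.
by apply: eq_bigr => j _; rewrite perm_actE permK.
Qed.

Lemma mono_mul m p :
  mono m * mono p = mono (fun j => m j + p j)%N :> (polydisc R n -> C).
Proof.
apply/funext => z; rewrite -[LHS]/(mono m z * mono p z) /mono -big_split.
by apply: eq_bigr => j _; rewrite exprD.
Qed.

Lemma mono0 : mono (fun=> 0%N) = 1 :> (polydisc R n -> C).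
Proof. by apply/funext => z; rewrite /mono big1// => j _; rewrite expr0. Qed.

Lemma poly_fun_sum (I : Type) (r : seq I) (P : pred I) (F : I -> mpoly.mpoly n C) :
  poly_fun (\sum_(i <- r | P i) F i) = \sum_(i <- r | P i) poly_fun (F i)
    :> (polydisc R n -> C).
Proof. by apply/funext => z; rewrite /poly_fun raddf_sum fct_sumE. Qed.

Definition sym_sum m : polydisc R n -> C := \sum_(s : 'S_n) mono (m \o s).

Lemma comp_perm_inv_sum (I : Type) (r : seq I) (P : pred I)
    (F : I -> polydisc R n -> C) s :
  comp_perm_inv (\sum_(i <- r | P i) F i) s =
  \sum_(i <- r | P i) comp_perm_inv (F i) s.
Proof. by apply/funext => z; rewrite /comp_perm_inv !fct_sumE. Qed.

Lemma sym_sum_perm m t : comp_perm_inv (sym_sum m) t = sym_sum m.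
Proof.
rewrite comp_perm_inv_sum [RHS](reindex_inj (mulgI t^-1%g)) /=.
apply: eq_bigr => s _; rewrite mono_perm; congr mono.
by apply/funext => j /=; rewrite permM.
Qed.

Lemma sym_sum_poly m : exists2 q : mpoly.mpoly n C,
  q \is mpoly.symmetric & poly_fun q = sym_sum m.
Proof.
pose x : mpoly.mpoly n C := mpoly.mpolyX C (mpoly.Multinom [tuple m i | i < n]).
exists (\sum_(s : 'S_n) mpoly.msym s x).
  apply/mpoly.issymP => t; rewrite raddf_sum [RHS](reindex_inj (mulIg t)) /=.
  by apply: eq_bigr => s _; rewrite mpoly.msymMm.
rewrite poly_fun_sum /sym_sum [RHS](reindex_inj invg_inj) /=.
apply: eq_bigr => s _; apply/funext => z.
rewrite /poly_fun mpoly.msymX mpoly.mevalX /mono; apply: eq_bigr => j _.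
by rewrite mpoly.mnmE /= mpoly.mnmE.
Qed.

Lemma mesym1_poly_fun :
  poly_fun (mpoly.mesym n C 1) =
  \sum_(j < n) mono (fun i => (i == j : nat)) :> (polydisc R n -> C).
Proof.
rewrite mpoly.mesym1E poly_fun_sum; apply: eq_bigr => j _; apply/funext => z.
rewrite /poly_fun mpoly.mevalXU /mono (bigD1 j)//= eqxx expr1 big1 ?mulr1// => i ij.
by rewrite (negbTE ij) expr0.
Qed.

Definition alt_sum m : polydisc R n -> C :=
  \sum_(s : 'S_n) ((-1) ^+ s : C) *: mono (m \o s).

Lemma alt_sum_perm m t : comp_perm_inv (alt_sum m) t = ((-1) ^+ t : C) *: alt_sum m.
Proof.
rewrite comp_perm_inv_sum scaler_sumr [RHS](reindex_inj (mulgI t^-1%g)) /=.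
apply: eq_bigr => s _.
rewrite -[LHS]/(((-1) ^+ s : C) *: comp_perm_inv (mono (m \o s)) t) mono_perm.
rewrite scalerA -signr_addb odd_permM odd_permV addbA addbb addFb; congr (_ *: mono _).
by apply/funext => j /=; rewrite permM.
Qed.

Lemma not_injective_perm m : ~ injective m -> exists t : 'S_n, odd_perm t /\ m \o t = m.
Proof.
move=> ninj; have [i [j [ij mij]]] : exists i, exists j, i != j /\ m i = m j.
  apply: contrapT => H; apply: ninj => i j mij; apply/eqP/negPn/negP => ij.
  by apply: H; exists i, j.
exists (tperm i j); split; first by rewrite odd_tperm.
by apply/funext => l /=; case: tpermP => [->|->|//].
Qed.

Lemma alt_sum_not_injective m : ~ injective m -> alt_sum m = 0.
Proof.
move=> /not_injective_perm[t [todd mt]].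
have : alt_sum m = - alt_sum m.
  rewrite {1}/alt_sum (reindex_inj (mulIg t)) /= -sumrN.
  apply: eq_bigr => s _; rewrite odd_permM todd addbT signrN scaleNr.
  have -> : m \o (s * t)%g = (m \o t) \o s by apply/funext => j /=; rewrite permM.
  by rewrite mt.
move=> /eqP; rewrite -addr_eq0 -mulr2n -scaler_nat scaler_eq0 pnatr_eq0 /=.
by move/eqP.
Qed.

Lemma mesym1_mul_alt_sum m :
  poly_fun (mpoly.mesym n C 1) * alt_sum m =
  \sum_(j < n) alt_sum (fun i => m i + (i == j))%N.
Proof.
rewrite mesym1_poly_fun mulr_suml.
under eq_bigr do rewrite /alt_sum mulr_sumr.
under [RHS]eq_bigr do rewrite /alt_sum.
rewrite exchange_big [RHS]exchange_big /=; apply: eq_bigr => s _.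
rewrite [RHS](reindex_inj (@perm_inj _ s)) /=; apply: eq_bigr => j _.
have scaleAr (c : C) f g : g * (c *: f) = c *: (g * f).
  by apply/funext => z; exact: mulrCA.
rewrite scaleAr mono_mul; congr (_ *: mono _).
by apply/funext => i /=; rewrite (inj_eq perm_inj) addnC.
Qed.

Variables (r : C) (r_gt0 : 0 < r) (r_lt1 : r < 1).
Local Notation avgr := (@avg R n r r_gt0 r_lt1).

Lemma avg_perm N m s f : avgr N m (comp_perm_inv f s) = avgr N (m \o s) f.
Proof.
pose h (J : {ffun 'I_n -> 'I_N.+1}) := [ffun j => J (s j)].
have h_inj : injective h.
  move=> J J' /ffunP e; apply/ffunP => j.
  by have := e (s^-1%g j); rewrite !ffunE permKV.
rewrite /avg [RHS](reindex_inj h_inj) /=; apply: eq_bigr => J _; congr (_ * _).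
  rewrite (reindex_inj (@perm_inj _ s)) /=.
  by apply: eq_bigr => j _; rewrite ffunE.
congr f; apply/val_inj/rowP => j.
by rewrite perm_actE !gridE ffunE.
Qed.

Lemma avg_sum (I : Type) (u : seq I) (P : pred I) N m (F : I -> polydisc R n -> C) :
  avgr N m (\sum_(i <- u | P i) F i) = \sum_(i <- u | P i) avgr N m (F i).
Proof.
rewrite /avg exchange_big /=; apply: eq_bigr => J _.
by rewrite fct_sumE mulr_sumr.
Qed.

Lemma avg_anti_not_injective N m g :
  (forall s, comp_perm_inv g s = ((-1) ^+ s : C) *: g) ->
  ~ injective m -> avgr N m g = 0.
Proof.
move=> gA /not_injective_perm[t [todd mt]].
have : avgr N m g = - avgr N m g.
  rewrite -[in LHS]mt -avg_perm gA todd expr1 scaleN1r /avg -sumrN.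
  by apply: eq_bigr => J _; rewrite -mulrN.
move=> /eqP; rewrite -addr_eq0 -mulr2n -mulr_natl mulf_eq0 pnatr_eq0 /=.
by move/eqP.
Qed.

Variable H : hilbert_space_of_functions R (polydisc R n).
Variables (k : C -> C) (a : nat -> C).
Hypothesis a_gt0 : forall i, 0 < a i.
Hypothesis series : forall x : C, `|x| < 1 ->
  tends_to (fun N => \sum_(i < N) a i * x ^+ i) (k x).
Hypothesis repK : reproducing_kernel H
  (fun z w => \prod_j k (val z 0 j * (val w 0 j)^*)).

Let Hmono m : carrier H (mono m) := carrier_mono a_gt0 series repK r_gt0 r_lt1 m.

Lemma carrier_sym_sum m : carrier H (sym_sum m).
Proof. by apply: carrier_sum => s _; exact: Hmono. Qed.

Lemma carrier_alt_sum m : carrier H (alt_sum m).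
Proof. by apply: carrier_sum => s _; apply: carrierZ; exact: Hmono. Qed.

Lemma dotp_mono_perm m s f (c : C) : carrier H f -> comp_perm_inv f s = c *: f ->
  dotp H f (mono (m \o s)) = c * dotp H f (mono m).
Proof.
move=> Hf fs.
have w0 : weight a r m != 0 by rewrite gt_eqF// weight_gt0.
have ws : weight a r (m \o s) = weight a r m.
  by rewrite [RHS](reindex_inj (@perm_inj _ s)).
have l1 := @avg_tends_to _ _ _ _ _ a_gt0 series repK _ r_gt0 r_lt1 (m \o s) _ Hf.
have l2 := @avg_tends_to _ _ _ _ _ a_gt0 series repK _ r_gt0 r_lt1 m _ (carrierZ c Hf).
apply: (mulfI w0); rewrite -{1}ws -(dotpZl c Hf (Hmono m)).
apply: (tends_to_unique l1); apply: tends_to_eq_near l2.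
by exists 0%N => N _; rewrite -fs avg_perm.
Qed.

Lemma dotp_sym_sum m f : carrier H f -> (forall s, comp_perm_inv f s = f) ->
  dotp H f (sym_sum m) = n`!%:R * dotp H f (mono m).
Proof.
move=> Hf fS; rewrite (dotp_sumr _ _ Hf)//.
have fmE s : dotp H f (mono (m \o s)) = dotp H f (mono m).
  by rewrite (@dotp_mono_perm m s f 1) ?mul1r// scale1r fS.
under eq_bigr do rewrite fmE.
by rewrite sumr_const card_Sn mulr_natl.
Qed.

Lemma dotp_alt_sum m f : carrier H f ->
  (forall s, comp_perm_inv f s = ((-1) ^+ s : C) *: f) ->
  dotp H f (alt_sum m) = n`!%:R * dotp H f (mono m).
Proof.
move=> Hf fA; have HT s : true -> carrier H (((-1) ^+ s : C) *: mono (m \o s)).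
  by move=> _; apply: carrierZ; exact: Hmono.
rewrite (dotp_sumr _ HT Hf).
have fmE s : dotp H f (((-1) ^+ s : C) *: mono (m \o s)) = dotp H f (mono m).
  rewrite (dotpZr _ (Hmono _) Hf) (dotp_mono_perm m Hf (fA s)).
  by rewrite rmorphXn rmorphN1 mulrA -expr2 sqrr_sign mul1r.
under eq_bigr do rewrite fmE.
by rewrite sumr_const card_Sn mulr_natl.
Qed.

Lemma dotp_alt_sum_self m : injective m ->
  dotp H (alt_sum m) (alt_sum m) = n`!%:R / \prod_j a (m j).
Proof.
move=> m_inj; rewrite dotp_alt_sum; [|exact: carrier_alt_sum|exact: alt_sum_perm].
have HT s : true -> carrier H (((-1) ^+ s : C) *: mono (m \o s)).
  by move=> _; apply: carrierZ; exact: Hmono.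
congr (_ * _); rewrite /alt_sum (dotp_suml _ HT (Hmono m)).
rewrite (bigD1 1%g)//= [X in _ + X]big1 ?addr0.
  rewrite (dotpZl _ (Hmono _) (Hmono _)) (dotp_mono a_gt0 series repK r_gt0 r_lt1).
  rewrite odd_perm1 expr0 mul1r (_ : [forall j, _]) ?mul1r//.
  by apply/forallP => j /=; rewrite perm1.
move=> s s1; rewrite (dotpZl _ (Hmono _) (Hmono _)).
rewrite (dotp_mono a_gt0 series repK r_gt0 r_lt1) (_ : [forall j, _] = false) ?mul0r ?mulr0//.
apply/negbTE; apply: contra s1 => /forallP ms.
by apply/eqP/permP => j; rewrite perm1; apply/esym/m_inj/eqP; exact: ms.
Qed.

Let delta : 'I_n -> nat := fun j => j.

Lemma avg_anti_tends_to0 p g : carrier H g ->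
  (forall s, comp_perm_inv g s = ((-1) ^+ s : C) *: g) ->
  (exists j, p j != 0%N) -> tends_to (fun N => avgr N delta (mono p * g)) 0.
Proof.
move=> Hg gA [j0 pj0].
have [high|low] := pselect (exists j, (delta j < p j)%N).
  have lim := avg_high_tends_to0 a_gt0 series repK r_gt0 r_lt1 Hg high.
  pose s N j := if (p j <= delta j)%N then (delta j - p j)%N
                else (N.+1 - (p j - delta j))%N.
  apply: (@tends_to_eq_near _ (fun N => (\prod_j r ^+ p j) * avgr N (s N) g)); last first.
    have := tends_toM (@tends_to_cst _ (\prod_j r ^+ p j)) lim.
    by rewrite mulr0.
  exists (\sum_j p j)%N => N pN; rewrite (@avg_mono_mul _ _ _ _ _ _ _ _ (s N))// => j.
  have pjN : (p j <= N)%N by apply: leq_trans pN; rewrite (bigD1 j)//= leq_addr.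
  rewrite /s; case: leqP => pd; first by rewrite subnK.
  rewrite (_ : _ + _ = N.+1 + delta j)%N ?modnDl//; lia.
have pd j : (p j <= delta j)%N by rewrite leqNgt; apply/negP => dp; apply: low; exists j.
pose s j := (delta j - p j)%N.
apply: (@tends_to_eq_near _ (fun=> 0)); last exact: tends_to_cst.
exists 0%N => N _; rewrite (@avg_mono_mul _ _ _ _ _ _ _ _ s); last first.
  by move=> j; rewrite subnK.
rewrite avg_anti_not_injective ?mulr0// => s_inj.
(* An injective s with s j <= j for all j is the identity. *)
have sid b : forall j : 'I_n, (j < b)%N -> s j = j.
  elim: b => // b IH j; rewrite ltnS leq_eqVlt => /orP[/eqP jb|]; last exact: IH.
  have [//|sj] := eqVneq (s j) j.
  have sjj : (s j < j)%N by rewrite ltn_neqAle sj leq_subr.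
  have sjn : (s j < n)%N := ltn_trans sjj (ltn_ord j).
  have e : s (Ordinal sjn) = s j by apply: IH; rewrite /= -jb.
  by move: sjj; rewrite -[j in X in (_ < X)%N](s_inj _ _ e) /= ltnn.
have := sid n j0 (ltn_ord j0); rewrite /s /delta => e.
by move: pj0 (pd j0); rewrite /delta; move: (p j0) e => P; move: (nat_of_ord j0); lia.
Qed.

End Permutations.

Section Equivalence.
Variables (R : realType) (n : nat).
Local Notation C := R[i].
Variable H : hilbert_space_of_functions R (polydisc R n.+1).
Variables (k : C -> C) (a : nat -> C).
Hypothesis a_gt0 : forall i, 0 < a i.
Hypothesis a0 : a 0%N = 1.
Hypothesis series : forall x : C, `|x| < 1 ->
  tends_to (fun N => \sum_(i < N) a i * x ^+ i) (k x).
Hypothesis repK : reproducing_kernel H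
  (fun z w => \prod_j k (val z 0 j * (val w 0 j)^*)).

Let r : C := 2^-1.
Let r_gt0 : 0 < r. Proof. by rewrite invr_gt0 ltr0n. Qed.
Let r_lt1 : r < 1. Proof. by rewrite invf_lt1 ?ltr0n// ltr1n. Qed.
Let Hmono m : carrier H (mono m) := carrier_mono a_gt0 series repK r_gt0 r_lt1 m.
Let dot_mono := dotp_mono a_gt0 series repK r_gt0 r_lt1.
Let delta : 'I_n.+1 -> nat := fun j => j.
Let e1 : polydisc R n.+1 -> C := poly_fun (mpoly.mesym n.+1 C 1).

Let one : polydisc R n.+1 -> C := mono (fun=> 0%N).

Let mul1 f : f * one = f. Proof. by rewrite /one mono0 mulr1. Qed.

Let one_sym : sym_part H one.
Proof. by split; [exact: Hmono | move=> s; rewrite mono_perm]. Qed.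

Let dotp11 : dotp H one one = 1.
Proof.
rewrite dot_mono (_ : [forall j, _]); last by apply/forallP.
by rewrite big1 ?divr1// => j _.
Qed.

Let sym_sum_sym m : sym_part H (sym_sum m).
Proof.
split; last exact: sym_sum_perm.
exact: (carrier_sym_sum r_gt0 r_lt1 a_gt0 series repK).
Qed.

Let alt_sum_anti m : anti_part H (alt_sum m).
Proof.
split; last exact: alt_sum_perm.
exact: (carrier_alt_sum r_gt0 r_lt1 a_gt0 series repK).
Qed.

Let delta_inj : injective delta. Proof. exact: val_inj. Qed.

Let fact_neq0 : (n.+1)`!%:R != 0 :> C.
Proof. by rewrite pnatr_eq0 -lt0n fact_gt0. Qed.

Let dotp_e1 : dotp H e1 e1 = n.+1%:R / a 1%N.
Proof.
have He1 : carrier H e1.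
  by rewrite /e1 mesym1_poly_fun; apply: carrier_sum => j _; exact: Hmono.
rewrite {1}/e1 mesym1_poly_fun (dotp_suml _ _ He1)//.
have col j : dotp H (mono (fun i => (i == j : nat))) e1 = (a 1%N)^-1.
  rewrite /e1 mesym1_poly_fun (dotp_sumr _ _ (Hmono _))//.
  rewrite (bigD1 j)//= [X in _ + X]big1 ?addr0.
    rewrite dot_mono (_ : [forall i, _]); last by apply/forallP.
    rewrite mul1r (bigD1 j)//= eqxx big1 ?mulr1// => i ij.
    by rewrite (negbTE ij).
  move=> i ij; rewrite dot_mono (_ : [forall l, _] = false) ?mul0r//.
  by apply/negbTE/negP => /forallP/(_ i); rewrite eqxx (negbTE ij).
by under eq_bigr do rewrite col; rewrite sumr_const card_ord mulr_natl.
Qed.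

Let top_monomial : 'I_n.+1 -> nat := fun i => (delta i + (i == ord_max))%N.

Let e1_mul_alt : e1 * alt_sum delta = alt_sum top_monomial.
Proof.
rewrite /e1 mesym1_mul_alt_sum (bigD1 ord_max)//= big1 ?addr0// => j jm.
apply: alt_sum_not_injective => inj.
have jn : (j.+1 < n.+1)%N.
  by rewrite ltnS ltn_neqAle -ltnS ltn_ord andbT; exact: jm.
have /(congr1 val)/= : j = Ordinal jn.
  apply: inj; rewrite /delta /= eqxx addn1 -val_eqE /=.
  by rewrite eqn_leq ltnn addn0.
by move/eqP; rewrite eqn_leq ltnn andbF.
Qed.

Let top_inj : injective top_monomial.
Proof.
move=> i j; rewrite /top_monomial /delta -!val_eqE /= => e; apply/val_inj => /=.
by have := ltn_ord i; have := ltn_ord j; move: e; do 2 case: eqP => /=; lia.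
Qed.

Lemma equivalence_coefficients :
  equivalent_sym_modules H (sym_part H) (anti_part H) ->
  a 1%N * a n = n.+1%:R * a n.+1.
Proof.
move=> [U [[UM Ulin Uiso Usurj] Umod]].
pose g := U one; have [Hg gA] : anti_part H g by exact: UM.
have [h hS Uh] := Usurj _ (alt_sum_anti delta).
have [Hh hs] := hS.
have [Halt _] := alt_sum_anti delta.
have orth m : (exists j, m j != 0%N) -> dotp H h (mono m) = 0.
  move=> [j0 mj0].
  have [Hs _] := sym_sum_sym m.
  suff : dotp H (sym_sum m) h = 0.
    rewrite (dotp_conj Hh Hs) (dotp_sym_sum r_gt0 r_lt1 a_gt0 series repK)// => /eqP.
    by rewrite conjC_eq0 mulf_eq0 (negbTE fact_neq0) => /eqP.
  have [q qS qE] := sym_sum_poly R m.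
  have UE : U (sym_sum m) = sym_sum m * g.
    by rewrite -[X in U X]mul1 -qE Umod.
  have [HU UA] := UM _ (sym_sum_sym m).
  rewrite -(Uiso _ _ (sym_sum_sym m) hS) Uh.
  rewrite (dotp_alt_sum r_gt0 r_lt1 a_gt0 series repK)//.
  have w0 : weight a r delta != 0 by rewrite gt_eqF// weight_gt0.
  apply/eqP; rewrite mulf_eq0 (negbTE fact_neq0) /=; apply/eqP/(mulfI w0).
  have lim := @avg_tends_to _ _ _ _ _ a_gt0 series repK _ r_gt0 r_lt1 delta _ HU.
  rewrite mulr0; apply: (tends_to_unique lim).
  rewrite UE /sym_sum mulr_suml; under eq_fun do rewrite avg_sum.
  have term s : true ->
      tends_to (fun N => avg r_gt0 r_lt1 N delta (mono (m \o (s : 'S_n.+1)) * g)) 0.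
    move=> _; apply: (avg_anti_tends_to0 r_gt0 r_lt1 a_gt0 series repK Hg gA).
    by exists (s^-1%g j0); rewrite /= permKV.
  have := @tends_to_sum _ _ (index_enum _) xpredT _ _ term.
  by rewrite big1_eq.
have [H1 _] := one_sym.
pose c := dotp H h one.
have hE : h = c *: one.
  apply/eqP; rewrite -subr_eq0; apply/eqP.
  apply: (mono_total a_gt0 series repK r_gt0 r_lt1).
    exact: carrierB (carrierZ _ H1).
  move=> m; rewrite (dotpBl Hh (carrierZ _ H1) (Hmono m)) (dotpZl _ H1 (Hmono m)).
  have [m0|m0] := pselect (exists j, m j != 0%N).
    rewrite orth// dot_mono (_ : [forall j, _] = false) ?mul0r ?mulr0 ?subrr//.
    by case: m0 => j mj; apply/negbTE/negP => /forallP/(_ j); rewrite (negbTE mj).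
  have -> : m = fun=> 0%N.
    by apply/funext => j; apply/eqP/negPn/negP => mj; apply: m0; exists j.
  by rewrite dotp11 mulr1 subrr.
have He1 : carrier H e1.
  by rewrite /e1 mesym1_poly_fun; apply: carrier_sum => j _; exact: Hmono.
have e1c : e1 * (c *: one) = c *: e1.
  by rewrite -[in RHS](mul1 e1); apply/funext => z; exact: mulrCA.
have e1S : sym_part H (e1 * h).
  rewrite hE; rewrite e1c.
  split; first exact: carrierZ.
  move=> s; apply/funext => z; rewrite -[RHS]/(c * e1 z) -[LHS]/(c * e1 (perm_act _ z)).
  congr (_ * _); rewrite /e1 mesym1_poly_fun !fct_sumE.
  rewrite [RHS](reindex_inj (@perm_inj _ s)) /=; apply: eq_bigr => j _.
  rewrite -[LHS]/(comp_perm_inv (mono _) s z) mono_perm; congr mono.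
  by apply/funext => i /=; rewrite -(inj_eq (@perm_inj _ s)) permKV.
have Ue1 : U (e1 * h) = alt_sum top_monomial.
  by rewrite Umod ?mpoly.mesym_sym// Uh e1_mul_alt.
have n1 : dotp H (alt_sum delta) (alt_sum delta) = c * c^*.
  by rewrite -Uh Uiso// hE (dotpZl _ H1 (carrierZ _ H1)) (dotpZr _ H1 H1) dotp11 mulr1.
have n2 : dotp H (alt_sum top_monomial) (alt_sum top_monomial)
    = c * c^* * (n.+1%:R / a 1%N).
  rewrite -Ue1 Uiso// hE; rewrite e1c.
  by rewrite (dotpZl _ He1 (carrierZ _ He1)) (dotpZr _ He1 He1) dotp_e1 mulrA.
move: n2; rewrite -n1 !(dotp_alt_sum_self r_gt0 r_lt1 a_gt0 series repK)//.
rewrite !big_ord_recr /= /top_monomial /delta /= eqxx addn1.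
have -> : \prod_(i < n) a (i + (widen_ord (leqnSn n) i == ord_max))%N = \prod_(i < n) a i.
  by apply: eq_bigr => i _; rewrite -val_eqE /= ltn_eqF// addn0.
have A0 : \prod_(i < n) a i != 0 by apply/prodf_neq0 => i _; rewrite gt_eqF.
have an : a n != 0 by rewrite gt_eqF.
have an1 : a n.+1 != 0 by rewrite gt_eqF.
have a1 : a 1%N != 0 by rewrite gt_eqF.
move: fact_neq0 A0; move: (_`!%:R) (\prod_(i < n) a i) => F A F0 A0 e.
apply: (mulfI F0); have := congr1 (fun x => x * A * a 1%N * a n * a n.+1) e.
have -> : F / (A * a n.+1) * A * a 1%N * a n * a n.+1 = F * (a 1%N * a n).
  by field; rewrite A0 an1.
by move=> ->; field; rewrite A0 an a1.
Qed.

End Equivalence.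

Theorem theorem4p5 (R : realType) (lambda : R) (n : nat)
    (A : hilbert_space_of_functions R (polydisc R n)) :
  0 < lambda -> (2 <= n)%N -> weighted_bergman_space lambda A ->
  ~ equivalent_sym_modules A (sym_part A) (anti_part A).
Proof.
move=> l0 n2 [_ repK]; case: n n2 A repK => [//|n] n2 A repK eqv.
pose a i : R[i] := (binomial_coef lambda i)%:C%C.
have a_gt0 i : 0 < a i by rewrite ltcR binomial_coef_gt0.
have a0 : a 0%N = 1 by rewrite /a binomial_coef0.
have series (x : R[i]) : `|x| < 1 ->
    tends_to (fun N => \sum_(i < N) a i * x ^+ i) (half_plane_power (1 - x) (- lambda)).
  exact: binomial_series.
have := @equivalence_coefficients _ _ A _ a a_gt0 a0 series repK eqv.
have a1 : a 1%N = lambda%:C%C.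
  have := binomial_coefS lambda 0; rewrite binomial_coef0 mul1r mulr1 addr0 => e.
  by rewrite /a e.
have -> : n.+1%:R * a n.+1 = (lambda + n%:R)%:C%C * a n.
  by rewrite /a -rmorphM -binomial_coefS rmorphM rmorph_nat.
have an : a n != 0 by rewrite gt_eqF.
rewrite a1 => /(mulIf an)/complexI/eqP.
rewrite -subr_eq0 opprD addNKr oppr_eq0 pnatr_eq0 => /eqP n0.
by rewrite n0 in n2.
Qed.
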